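(* Let $X$ be an infinite set such that $|X|$ is a singular cardinal, and let $\alpha,\beta\in\mathcal P_X$. Then $\mathcal P_X=\langle\mathcal S_X\cup\{\alpha,\beta\}\rangle$ if and only if, up to interchanging the names of $\alpha$ and $\beta$ if necessary, $\alpha\in\mathcal L_X$, $\beta\in\mathcal R_X$, $d^*(\alpha)=d(\beta)=|X|$, and either (i) $k^*(\alpha,2)+d^*(\alpha,2)=|X|=k(\beta,\mu)+d(\beta,\mu)$ for all cardinals $\mu<|X|$, or (ii) $k^*(\alpha,\mu)+d^*(\alpha,\mu)=|X|=k(\beta,2)+d(\beta,2)$ for all cardinals $\mu<|X|$.
   Context: Partition monoid: let $X'=\{x':x\in X\}$ be a disjoint copy of the set $X$; for $A\subseteq X$ write $A'=\{a':a\in A\}$. The elements of $\mathcal P_X$ are all set partitions $\alpha$ of $X\cup X'$ into nonempty blocks. Product: given $\alpha,\beta\in\mathcal P_X$, let $X''=\{x'':x\in X\}$ be a third disjoint copy of $X$; relabel each lower vertex $x'$ of (a graph whose connected components are the blocks of) $\alpha$ as $x''$, relabel each upper vertex $x$ of (a graph representing) $\beta$ as $x''$, and take the union of the two graphs on vertex set $X\cup X''\cup X'$. Then $\alpha\beta\in\mathcal P_X$ is the partition in which $u,v\in X\cup X'$ lie in the same block if and only if they are joined by a (finite) path in this graph. This makes $\mathcal P_X$ a monoid with identity $\{\{x,x'\}:x\in X\}$. $\mathcal S_X$ denotes the group of units of $\mathcal P_X$: the partitions all of whose blocks have the form $\{x,y'\}$ with $x,y\in X$. For $T\subseteq\mathcal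 P_X$, $\langle T\rangle$ is the subsemigroup generated by $T$. $\mathcal L_X$ is the set of $\alpha\in\mathcal P_X$ such that every $x\in X$ lies in a block meeting $X'$ and distinct elements of $X$ lie in distinct blocks. $\mathcal R_X$ is the set of $\alpha\in\mathcal P_X$ such that every $x'\in X'$ lies in a block meeting $X$ and distinct elements of $X'$ lie in distinct blocks. Parameters: write the blocks of $\alpha\in\mathcal P_X$ as transversal blocks $A_i\cup B_i'$ ($i\in I$) with $A_i,B_i\subseteq X$ nonempty, upper nontransversal blocks $C_j\subseteq X$ ($j\in J$), and lower nontransversal blocks $D_k'\subseteq X'$ ($k\in K$). For a cardinal $\mu\le|X|$ put $k(\alpha,\mu)=|\{i\in I:|A_i|\ge\mu\}|$, $k^*(\alpha,\mu)=|\{i\in I:|B_i|\ge\mu\}|$, $d(\alpha,\mu)=|\{j\in J:|C_j|\ge\mu\}|$, $d^*(\alpha,\mu)=|\{k\in K:|D_k|\ge\mu\}|$, and $d(\alpha)=d(\alpha,1)=|J|$, $d^*(\alpha)=d^*(\alpha,1)=|K|$. A cardinal $\mu$ is singular if a set of cardinality $\mu$ can be written as a union of fewer than $\mu$ subsets each of cardinality less than $\mu$. *)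

(* Defs.v *)
From HB Require Import structures.
From Stdlib Require Import Relations.
From mathcomp Require Import all_boot.
From mathcomp Require Import all_classical.

Set Implicit Arguments.
Unset Strict Implicit.
Unset Printing Implicit Defensive.

Local Open Scope classical_set_scope.
Local Open Scope card_scope.

Reserved Notation "A '#<' B" (at level 79, format "A  '#<'  B").

Definition card_lt T U (A : set T) (B : set U) : Prop :=
  A #<= B /\ ~ (B #<= A).
Notation "A '#<' B" := (card_lt A B) : card_scope.

(* The disjoint union of A and B: its cardinal is the sum of theirs. *)
Definition set_sum T U (A : set T) (B : set U) : set (T + U) :=
  [set u | match u with inl a => A a | inr b => B b end].

(* The cardinal of A is singular. *)
Definition singular T (A : set T) : Prop :=
  exists F : set (set T),
    [/\ F #< A, forall B, F B -> B #< A & \bigcup_(B in F) B = A].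

(* In X + X, inl x is the upper vertex x and inr x is the lower vertex x'. *)
Record partmon (X : Type) := PartMon {
  blocks : set (set (X + X));
  blocksP : partition blocks id [set: X + X]
}.

HB.instance Definition _ (X : Type) := gen_eqMixin (partmon X).
HB.instance Definition _ (X : Type) := gen_choiceMixin (partmon X).

Definition same_block X (a : partmon X) (u v : X + X) : Prop :=
  exists2 U, blocks a U & U u /\ U v.

Section SameBlock.
Context {X : Type}.
Implicit Types (a b : partmon X) (u v w : X + X) (U V : set (X + X)).

Lemma block_nonempty a U : blocks a U -> U !=set0.
Proof. by case: (blocksP a) => _ _; apply. Qed.

Lemma block_inj a U V u : blocks a U -> blocks a V -> U u -> V u -> U = V.
Proof.
by case: (blocksP a) => _ tU _ aU aV Uu Vu; apply: tU => //; exists u.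
Qed.

Lemma same_block_refl a u : same_block a u u.
Proof.
case: (blocksP a) => cU _ _.
have: [set: X + X] u by [].
by rewrite -cU => -[U aU Uu]; exists U.
Qed.

Lemma same_block_sym a u v : same_block a u v -> same_block a v u.
Proof. by case=> U aU [Uu Uv]; exists U. Qed.

Lemma same_block_trans a v u w :
  same_block a u v -> same_block a v w -> same_block a u w.
Proof.
move=> [U aU [Uu Uv]] [V aV [Vv Vw]]; exists U => //; split=> //.
by rewrite (block_inj aU aV Uv Vv).
Qed.

Lemma blocksE a U :
  blocks a U <-> exists u, U = [set v | same_block a u v].
Proof.
split=> [aU|[u ->]].
  have [u Uu] := block_nonempty aU.
  exists u; apply/seteqP; split=> [v Uv|v [V aV [Vu Vv]]]; first by exists U.
  by rewrite (block_inj aU aV Uu Vu).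
have [V aV [Vu _]] := same_block_refl a u.
suff -> : [set v | same_block a u v] = V by [].
apply/seteqP; split=> [v [W aW [Wu Wv]]|v Vv]; last by exists V.
by rewrite (block_inj aV aW Vu Wu).
Qed.

Lemma partmon_eq a b :
  (forall u v, same_block a u v <-> same_block b u v) -> a = b.
Proof.
move=> ab; have eqs u : [set v | same_block a u v] = [set v | same_block b u v].
  by apply/seteqP; split=> v /ab.
have: blocks a = blocks b.
  apply/seteqP; split=> U /blocksE[u ->]; apply/blocksE; exists u => //.
case: a b {ab eqs} => [A pA] [B pB] /= AB; subst B.
by rewrite (Prop_irrelevance pA pB).
Qed.

End SameBlock.

Section OfRel.
Context {X : Type} (E : X + X -> X + X -> Prop)
  (Erefl : forall u, E u u) (Esym : forall u v, E u v -> E v u)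
  (Etrans : forall u v w, E u v -> E v w -> E u w).

Lemma classes_partition :
  partition [set [set v | E u v] | u in [set: X + X]] id [set: X + X].
Proof.
split.
- by apply/seteqP; split=> // u _; exists [set v | E u v] => //=; exists u.
- move=> _ _ [u _ <-] [v _ <-] [w [/= uw vw]].
  by apply/seteqP; split=> z /= h;
    [apply: (Etrans vw); apply: (Etrans (Esym uw))
    |apply: (Etrans uw); apply: (Etrans (Esym vw))].
- by move=> _ [u _ <-]; exists u => /=.
Qed.

Definition partmon_of_rel : partmon X := PartMon classes_partition.

Lemma same_block_of_rel u v : same_block partmon_of_rel u v <-> E u v.
Proof.
split=> [[_ [w _ <-] [/= wu wv]]|uv]; first exact: Etrans (Esym wu) wv.
by exists [set z | E u z]; [exists u|split=> /=].
Qed.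

End OfRel.

Section Product.
Context {X : Type}.
Implicit Types (a b c : partmon X) (u v w : X + X).

(* The vertices x, x'' and x' of the product graph. *)
Inductive vertex := Up of X | Mid of X | Low of X.

Definition relabel_low u := match u with inl x => Up x | inr x => Mid x end.
Definition relabel_up u := match u with inl x => Mid x | inr x => Low x end.
Definition outer u := match u with inl x => Up x | inr x => Low x end.

(* Each block is represented by the complete graph on it. *)
Inductive edge a b : vertex -> vertex -> Prop :=
| edge_l u v : same_block a u v -> edge a b (relabel_low u) (relabel_low v)
| edge_r u v : same_block b u v -> edge a b (relabel_up u) (relabel_up v).

Definition joined a b : vertex -> vertex -> Prop :=
  clos_refl_trans vertex (edge a b).

Lemma joined_sym a b p q : joined a b p q -> joined a b q p.
Proof.
elim=> [_ _ [u v|u v] /same_block_sym uv|r|r s t _ sr _ ts].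
- by apply: rt_step; left.
- by apply: rt_step; right.
- exact: rt_refl.
- exact: rt_trans ts sr.
Qed.

Lemma outer_refl a b u : joined a b (outer u) (outer u).
Proof. exact: rt_refl. Qed.

Lemma outer_sym a b u v :
  joined a b (outer u) (outer v) -> joined a b (outer v) (outer u).
Proof. exact: joined_sym. Qed.

Lemma outer_trans a b u v w : joined a b (outer u) (outer v) ->
  joined a b (outer v) (outer w) -> joined a b (outer u) (outer w).
Proof. exact: rt_trans. Qed.

Definition pmul a b : partmon X :=
  partmon_of_rel (@outer_refl a b) (@outer_sym a b) (@outer_trans a b).

Lemma same_block_mul a b u v :
  same_block (pmul a b) u v <-> joined a b (outer u) (outer v).
Proof. exact: same_block_of_rel. Qed.

Lemma pone_partition :
  partition [set [set inl x; inr x] | x in [set: X]] id [set: X + X].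
Proof.
split.
- apply/seteqP; split=> // -[] x _ /=.
    by exists [set inl x; inr x]; [exists x|left].
  by exists [set inl x; inr x]; [exists x|right].
- by move=> _ _ [x _ <-] [y _ <-] [w [/= [] -> [] // [->]]].
- by move=> _ [x _ <-]; exists (inl x); left.
Qed.

Definition pone : partmon X := PartMon pone_partition.

Lemma same_block_one u v : same_block pone u v <->
  match u, v with inl x, inl y | inl x, inr y | inr x, inl y | inr x, inr y =>
    x = y end.
Proof.
split.
  by case=> _ [z _ <-] [] /= [] -> [] -> //=.
have bx x : blocks pone [set inl x; inr x] by exists x.
by case: u v => x [] y <-; (exists [set inl x; inr x]; first exact: bx);
  split; rewrite /=; tauto.
Qed.

Lemma pmul1p : left_id pone pmul.
Proof.
move=> a; apply: partmon_eq => u v; rewrite same_block_mul; split.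
  pose f p := match p with Up x | Mid x => inl x | Low x => inr x end.
  have fK w : f (outer w) = w by case: w.
  suff h p q : joined pone a p q -> same_block a (f p) (f q).
    by move/h; rewrite !fK.
  elim=> [_ _ [{}u {}v /same_block_one uv|w z wz]|r|r s t _ rs _ st].
  - have -> : f (relabel_low u) = f (relabel_low v).
      by case: u v uv => x [] y /= ->.
    exact: same_block_refl.
  - by move: wz; case: w z => x [] y.
  - exact: same_block_refl.
  - exact: same_block_trans rs st.
move=> uv.
have h w : joined pone a (outer w) (relabel_up w).
  case: w => x; last exact: rt_refl.
  by apply: rt_step; apply: (@edge_l pone a (inl x) (inr x));
    apply/same_block_one.
apply: rt_trans (h u) (rt_trans _ _ _ _ _ _ (joined_sym (h v))).
by apply: rt_step; right.
Qed.

Lemma pmulp1 : right_id pone pmul.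
Proof.
move=> a; apply: partmon_eq => u v; rewrite same_block_mul; split.
  pose f p := match p with Up x => inl x | Mid x | Low x => inr x end.
  have fK w : f (outer w) = w by case: w.
  suff h p q : joined a pone p q -> same_block a (f p) (f q).
    by move/h; rewrite !fK.
  elim=> [_ _ [w z wz|{}u {}v /same_block_one uv]|r|r s t _ rs _ st].
  - by move: wz; case: w z => x [] y.
  - have -> : f (relabel_up u) = f (relabel_up v).
      by case: u v uv => x [] y /= ->.
    exact: same_block_refl.
  - exact: same_block_refl.
  - exact: same_block_trans rs st.
move=> uv.
have h w : joined a pone (outer w) (relabel_low w).
  case: w => x; first exact: rt_refl.
  apply: joined_sym.
  by apply: rt_step; apply: (@edge_r a pone (inl x) (inr x));
    apply/same_block_one.
apply: rt_trans (h u) (rt_trans _ _ _ _ _ _ (joined_sym (h v))).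
by apply: rt_step; left.
Qed.

(* Both bracketings of a triple product are read off the same graph on four
   copies of X. *)
Let vertex4 : Type := (nat * X)%type.
Let layer (i : nat) u : vertex4 :=
  match u with inl x => (i, x) | inr x => (i.+1, x) end.
Let outer4 u : vertex4 := match u with inl x => (0, x) | inr x => (3, x) end.

Inductive edge4 a b c : vertex4 -> vertex4 -> Prop :=
| edge4_0 u v : same_block a u v -> edge4 a b c (layer 0 u) (layer 0 v)
| edge4_1 u v : same_block b u v -> edge4 a b c (layer 1 u) (layer 1 v)
| edge4_2 u v : same_block c u v -> edge4 a b c (layer 2 u) (layer 2 v).

Let joined4 a b c := clos_refl_trans vertex4 (edge4 a b c).

Let closed_joined T (E : T -> T -> Prop) (P : T -> Prop) p q :
  (forall r s, E r s -> P r -> P s) -> clos_refl_trans T E p q -> P p -> P q.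
Proof. by move=> h; elim=> [r s /h|//|r s t _ rs _ st /rs]. Qed.

Lemma joined_mull a b c u v : joined (pmul a b) c (outer u) (outer v) <->
  joined4 a b c (outer4 u) (outer4 v).
Proof.
split.
  pose f p : vertex4 :=
    match p with Up x => (0, x) | Mid x => (2, x) | Low x => (3, x) end.
  have fo w : outer4 w = f (outer w) by case: w.
  rewrite !fo; elim=> [_ _ [w z|w z wz]|r|r s t _ rs _ st].
  - rewrite same_block_mul.
    pose g p : vertex4 :=
      match p with Up x => (0, x) | Mid x => (1, x) | Low x => (2, x) end.
    have go x : f (relabel_low x) = g (outer x) by case: x.
    rewrite !go; elim=> [_ _ [{}w {}z wz|{}w {}z wz]|r|r s t _ rs _ st].
    + by apply: rt_step; move: (edge4_0 b c wz); case: (w) (z) => ? [].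
    + by apply: rt_step; move: (edge4_1 a c wz); case: (w) (z) => ? [].
    + exact: rt_refl.
    + exact: rt_trans rs st.
  - by apply: rt_step; move: (edge4_2 a b wz); case: (w) (z) => ? [].
  - exact: rt_refl.
  - exact: rt_trans rs st.
pose Q p := exists2 z, joined (pmul a b) c (outer u) (relabel_low z)
                     & joined a b (outer z) p.
have Qo z : Q (outer z) -> joined (pmul a b) c (outer u) (relabel_low z).
  move=> [y uy yz]; apply: rt_trans uy _; apply: rt_step; left.
  exact/same_block_mul.
have oQ z : joined (pmul a b) c (outer u) (relabel_low z) -> Q (outer z).
  by move=> uz; exists z => //; apply: rt_refl.
pose P (p : vertex4) := match p.1 with
  | 0 => Q (Up p.2) | 1 => Q (Mid p.2) | 2 => Q (Low p.2)
  | _ => joined (pmul a b) c (outer u) (Low p.2) end.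
have QE p q : edge a b p q -> Q p -> Q q.
  by move=> pq [z uz zp]; exists z => //; apply: rt_trans zp (rt_step _ _ _ _ pq).
have P2 z : P (layer 2 z) <-> joined (pmul a b) c (outer u) (relabel_up z).
  case: z => x //=; split; first exact: (@Qo (inr x)).
  exact: (@oQ (inr x)).
move=> uv; have: P (outer4 v).
  apply: (closed_joined _ uv) => [_ _ [w z wz|w z wz|w z wz]|].
  - by move/(_ _ _ (edge_l b wz)): QE; case: (w) (z) => ? [].
  - by move/(_ _ _ (edge_r a wz)): QE; case: (w) (z) => ? [].
  - by rewrite !P2 => uw; apply: rt_trans uw _; apply: rt_step; right.
  - have Pu z : joined (pmul a b) c (outer u) (outer z) -> P (outer4 z).
      by case: z => x //= /(oQ (inl x)).
    by apply: Pu; apply: rt_refl.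
by case: (v) => x //= /(Qo (inl x)).
Qed.

Lemma joined_mulr a b c u v : joined a (pmul b c) (outer u) (outer v) <->
  joined4 a b c (outer4 u) (outer4 v).
Proof.
split.
  pose f p : vertex4 :=
    match p with Up x => (0, x) | Mid x => (1, x) | Low x => (3, x) end.
  have fo w : outer4 w = f (outer w) by case: w.
  rewrite !fo; elim=> [_ _ [w z wz|w z]|r|r s t _ rs _ st].
  - by apply: rt_step; move: (edge4_0 b c wz); case: (w) (z) => ? [].
  - rewrite same_block_mul.
    pose g p : vertex4 :=
      match p with Up x => (1, x) | Mid x => (2, x) | Low x => (3, x) end.
    have go x : f (relabel_up x) = g (outer x) by case: x.
    rewrite !go; elim=> [_ _ [{}w {}z wz|{}w {}z wz]|r|r s t _ rs _ st].
    + by apply: rt_step; move: (edge4_1 a c wz); case: (w) (z) => ? [].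
    + by apply: rt_step; move: (edge4_2 a b wz); case: (w) (z) => ? [].
    + exact: rt_refl.
    + exact: rt_trans rs st.
  - exact: rt_refl.
  - exact: rt_trans rs st.
pose Q p := exists2 z, joined a (pmul b c) (outer u) (relabel_up z)
                     & joined b c (outer z) p.
have Qo z : Q (outer z) -> joined a (pmul b c) (outer u) (relabel_up z).
  move=> [y uy yz]; apply: rt_trans uy _; apply: rt_step; right.
  exact/same_block_mul.
have oQ z : joined a (pmul b c) (outer u) (relabel_up z) -> Q (outer z).
  by move=> uz; exists z => //; apply: rt_refl.
pose P (p : vertex4) := match p.1 with
  | 0 => joined a (pmul b c) (outer u) (Up p.2)
  | 1 => Q (Up p.2) | 2 => Q (Mid p.2) | _ => Q (Low p.2) end.
have QE p q : edge b c p q -> Q p -> Q q.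
  by move=> pq [z uz zp]; exists z => //; apply: rt_trans zp (rt_step _ _ _ _ pq).
have P0 z : P (layer 0 z) <-> joined a (pmul b c) (outer u) (relabel_low z).
  case: z => x //=; split; first exact: (@Qo (inl x)).
  exact: (@oQ (inl x)).
move=> uv; have: P (outer4 v).
  apply: (closed_joined _ uv) => [_ _ [w z wz|w z wz|w z wz]|].
  - by rewrite !P0 => uw; apply: rt_trans uw _; apply: rt_step; left.
  - by move/(_ _ _ (edge_l c wz)): QE; case: (w) (z) => ? [].
  - by move/(_ _ _ (edge_r b wz)): QE; case: (w) (z) => ? [].
  - have Pu z : joined a (pmul b c) (outer u) (outer z) -> P (outer4 z).
      by case: z => x //= /(oQ (inr x)).
    by apply: Pu; apply: rt_refl.
by case: (v) => x //= /(Qo (inr x)).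
Qed.

Lemma pmulpA : associative pmul.
Proof.
move=> a b c; apply: partmon_eq => u v.
by rewrite !same_block_mul joined_mulr joined_mull.
Qed.

End Product.

HB.instance Definition _ (X : Type) :=
  isMonoid.Build (partmon X) (@pmulpA X) (@pmul1p X) (@pmulp1 X).

(* The group of units; sym_grpP describes it by blocks. *)
Definition sym_grp (X : Type) : set (partmon X) :=
  [set a | exists b, (a * b = 1)%g /\ (b * a = 1)%g].

Section SymGrp.
Context {X : Type}.
Implicit Types (a b : partmon X).

Let swap (u : X + X) : X + X :=
  match u with inl x => inr x | inr x => inl x end.
Let swapped a (u v : X + X) := same_block a (swap u) (swap v).

Let flip a : partmon X :=
  @partmon_of_rel X (swapped a) (fun u => same_block_refl a (swap u))
    (fun u v => @same_block_sym X a (swap u) (swap v))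
    (fun u v w => @same_block_trans X a (swap v) (swap u) (swap w)).

Let same_flip a u v : same_block (flip a) u v <-> same_block a (swap u) (swap v).
Proof. exact: same_block_of_rel. Qed.

Let flipK a : flip (flip a) = a.
Proof. by apply: partmon_eq => u v; rewrite !same_flip; case: u v => ? []. Qed.

Let mul_flip a : (forall x, exists y, same_block a (inl x) (inr y)) ->
  (forall x y, same_block a (inl x) (inl y) -> x = y) -> (a * flip a = 1)%g.
Proof.
move=> aT aI; apply: partmon_eq => u v; rewrite same_block_mul; split.
  pose g p : X + X :=
    match p with Up x => inl x | Mid x => inr x | Low x => inl x end.
  have h p q : joined a (flip a) p q -> same_block a (g p) (g q).
    elim=> [_ _ [w z wz|w z /same_flip wz]|r|r s t _ rs _ st].
    + by move: wz; case: w z => ? [].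
    + by move: wz; case: w z => ? [].
    + exact: same_block_refl.
    + exact: same_block_trans rs st.
  by move/h => uv; apply/same_block_one; move: uv; case: u v => x [] y /aI.
have h x : joined a (flip a) (Up x) (Low x).
  have [y xy] := aT x; apply: (rt_trans _ _ _ (Mid y)); apply: rt_step.
    exact: (edge_l (flip a) xy).
  by apply: (@edge_r _ a (flip a) (inl y) (inr x)); apply/same_flip/same_block_sym.
move/same_block_one; case: u v => x [] y <-; try exact: rt_refl.
  exact: h.
exact: joined_sym (h x).
Qed.

Let unit_upper a b : (a * b = 1)%g ->
  (forall x, exists y, same_block a (inl x) (inr y)) /\
  (forall x y, same_block a (inl x) (inl y) -> x = y).
Proof.
move=> ab; split=> [x|x y xy]; last first.
  have: same_block (1%g : partmon X) (inl x) (inl y).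
    rewrite -ab; apply/same_block_mul; apply: rt_step.
    exact: (edge_l b xy).
  by move/same_block_one.
apply: contrapT => nx.
have: same_block (1%g : partmon X) (inl x) (inr x) by apply/same_block_one.
rewrite -ab => /same_block_mul.
pose P p := match p with Up z => same_block a (inl x) (inl z) | _ => False end.
suff h p q : joined a b p q -> P p -> P q.
  by move/h; apply; apply: same_block_refl.
elim=> [_ _ [w z|w z]|//|r s t _ rs _ st /rs //].
  case: w z => [w|w] [z|z] //= wz xw; first exact: same_block_trans xw wz.
  by apply: nx; exists z; apply: same_block_trans xw wz.
by case: w z => [w|w] [z|z].
Qed.

Let flipM a b : flip (a * b)%g = (flip b * flip a)%g.
Proof.
have h c d p q : joined c d p q ->
    let f p := match p with Up x => Low x | Mid x => Mid x | Low x => Up x end in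
    joined (flip d) (flip c) (f p) (f q).
  elim=> [_ _ [w z wz|w z wz]|r|r s t _ rs _ st] f.
  - have: same_block (flip c) (swap w) (swap z).
      by apply/same_flip; move: wz; case: w z => ? [].
    move/(edge_r (flip d)) => e; apply: rt_step.
    by move: e; case: w z wz => ? [].
  - have: same_block (flip d) (swap w) (swap z).
      by apply/same_flip; move: wz; case: w z => ? [].
    move=> /(@edge_l _ _ (flip c)) e; apply: rt_step.
    by move: e; case: w z wz => ? [].
  - exact: rt_refl.
  - exact: rt_trans rs st.
apply: partmon_eq => u v; rewrite same_flip !same_block_mul; split=> /h /=.
  by case: u v => ? [].
by rewrite !flipK; case: u v => ? [].
Qed.

Let flip1 : flip 1%g = 1%g.
Proof.
apply: partmon_eq => u v; rewrite same_flip; split=> /same_block_one uv;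
  by apply/same_block_one; move: uv; case: u v => ? [].
Qed.

Lemma sym_grpP a : sym_grp a <->
  forall U, blocks a U -> exists x y, U = [set inl x; inr y].
Proof.
split=> [[b [ab ba]] U aU|h].
  have [aT aI] := unit_upper ab.
  have [a'T a'I] : (forall x, exists y, same_block (flip a) (inl x) (inr y)) /\
      (forall x y, same_block (flip a) (inl x) (inl y) -> x = y).
    by apply: (@unit_upper _ (flip b)); rewrite -flipM ba flip1.
  have [x Ux] : exists x, U (inl x).
    have [[x Ux|y Uy]] := block_nonempty aU; first by exists x.
    have [x /same_flip[V aV /= [Vy Vx]]] := a'T y.
    by exists x; rewrite (block_inj aU aV Uy Vy).
  have [y [V aV [Vx Vy]]] := aT x.
  have {V aV Vx Vy}Uy : U (inr y) by rewrite (block_inj aU aV Ux Vx).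
  exists x, y; apply/seteqP; split=> [[z|z] Uz|z [] -> //].
    by left; congr inl; apply: aI; exists U.
  by right; congr inr; apply: a'I; apply/same_flip; exists U.
have aB u v : same_block a u v ->
    exists x y, [/\ same_block a (inl x) (inr y),
      u = inl x \/ u = inr y & v = inl x \/ v = inr y].
  move=> [U aU [Uu Uv]]; have [x [y Uxy]] := h U aU; exists x, y.
  move: Uu Uv; rewrite Uxy; split=> //.
  by exists U => //; rewrite Uxy; split; [left|right].
exists (flip a); split.
  apply: mul_flip => [x|x y].
    have [z [y [zy [[->]|//] _]]] := aB _ _ (same_block_refl a (inl x)).
    by exists y.
  by move=> /aB[z [t [_ [[->]|//] [[->]|]]]].
rewrite -{2}(flipK a); apply: mul_flip => [x|x y].
  have [z [y [zy [//|[->]] _]]] := aB _ _ (same_block_refl a (inr x)).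
  by exists z; apply/same_flip/same_block_sym.
by move=> /same_flip/aB[z [t [_ [//|[->]] [|[->]]]]].
Qed.

End SymGrp.

Definition subsemigroup_gen (S : semigroupType) (G : set S) : set S :=
  smallest [set H : set S | forall a b, H a -> H b -> H (a * b)%g] G.

Section BlockCounts.
Context {X : Type}.
Implicit Types (a : partmon X) (U : set (X + X)).

Definition upper U : set X := inl @^-1` U.
Definition lower U : set X := inr @^-1` U.

Definition transversal U : Prop := upper U !=set0 /\ lower U !=set0.

Definition in_L (a : partmon X) : Prop :=
  (forall x, exists2 U, blocks a U & upper U x /\ lower U !=set0) /\
  (forall U x y, blocks a U -> upper U x -> upper U y -> x = y).

Definition in_R (a : partmon X) : Prop :=
  (forall x, exists2 U, blocks a U & lower U x /\ upper U !=set0) /\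
  (forall U x y, blocks a U -> lower U x -> lower U y -> x = y).

(* In the four parameters below, a cardinal mu is given by a set mu of that
   cardinality (`I_n for a natural number n), and the parameter itself is the
   cardinal of the given set of blocks. *)
Definition k_up a M (mu : set M) : set (set (X + X)) :=
  [set U | [/\ blocks a U, transversal U & mu #<= upper U]].
Definition k_low a M (mu : set M) : set (set (X + X)) :=
  [set U | [/\ blocks a U, transversal U & mu #<= lower U]].
Definition d_up a M (mu : set M) : set (set (X + X)) :=
  [set U | [/\ blocks a U, lower U = set0 & mu #<= upper U]].
Definition d_low a M (mu : set M) : set (set (X + X)) :=
  [set U | [/\ blocks a U, upper U = set0 & mu #<= lower U]].

End BlockCounts.

(* Main.v *)
Require Import Defs.
From Stdlib Require Import Relations.
From mathcomp Require Import all_boot.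
From mathcomp Require Import all_classical.

(* Sufficiency.  An element of L_X is a family of disjoint nonempty sets B_x, one
   for each upper point x, together with lower nontransversal blocks; elements of
   R_X are dual.  In a product a h b with h a permutation, a in L_X and b in R_X,
   the permutation decides how the lower parts of the blocks of a are glued to the
   upper parts of the blocks of b.  In case (i) one first replaces alpha and beta by
   products alpha h alpha and beta h' beta, so that the large blocks required become
   nontransversal.  Singularity splits |X| into fewer than |X| smaller cardinals, so
   |X| disjoint groups of fewer than |X| upper nontransversal blocks of b can be
   chosen, each group covering |X| points.  Two-element pieces of lower
   nontransversal blocks of a connect each group, and then every element g is of the
   form a h b.  Case (ii) is case (i) for the images under the anti-involution flip.

   Necessity.  The complement of L_X is a right ideal and the intersection of L_X and
   R_X is the unit group, so one generator is in L_X and the other in R_X.  Each of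
   the counting conditions is forced because having fewer than |X| blocks of the kind
   in question is inherited by products. *)

Set Implicit Arguments.
Unset Strict Implicit.
Unset Printing Implicit Defensive.

Local Open Scope classical_set_scope.
Local Open Scope card_scope.

(** * Cardinals *)

(** The point [u0] makes a total function into [U] available even when [A] is empty. *)
Lemma card_le_funP T U (u0 : U) (A : set T) (B : set U) : A #<= B ->
  exists2 f : T -> U, (forall x, A x -> B (f x)) &
    forall x y, A x -> A y -> f x = f y -> x = y.
Proof.
elim/Ppointed: U => U in u0 B *; first by case: (no u0).
move/pcard_leP/injfunPex => [f fAB finj]; exists f => [//|x y Ax Ay].
by apply: finj; rewrite inE.
Qed.

(** Injections below often depend on a choice of representatives. A relation in which no target has
    two sources suffices, and choice extracts the function. *)
Lemma card_le_rel T U (A : set T) (B : set U) (R : T -> U -> Prop) :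
  (forall x, A x -> exists2 y, B y & R x y) ->
  (forall x x' y, A x -> A x' -> B y -> R x y -> R x' y -> x = x') -> A #<= B.
Proof.
elim/Ppointed: U => U in B R *.
  move=> AB _; have -> : A = set0; last exact: card_ge0.
  by rewrite -subset0 => x /AB[y]; case: (no y).
move=> AB Rinj.
have /choice[f fP] x : exists y, A x -> B y /\ R x y.
  by have [/AB[y ? ?]|?] := pselect (A x); [exists y|exists point].
apply/pcard_leP/injfunPex; exists f => [x /fP[]//|x y].
rewrite !inE => Ax Ay fxy; have [Bx Rx] := fP _ Ax; have [_ Ry] := fP _ Ay.
by apply: Rinj Rx _ => //; rewrite fxy.
Qed.

Lemma card_le_fun T U (A : set T) (B : set U) (f : T -> U) :
  (forall x, A x -> B (f x)) ->
  (forall x y, A x -> A y -> f x = f y -> x = y) -> A #<= B.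
Proof.
move=> fAB finj; apply: (@card_le_rel _ _ _ _ (fun x y => f x = y)).
  by move=> x Ax; exists (f x) => //; apply: fAB.
by move=> x x' y Ax Ax' _ <- /esym; apply: finj.
Qed.

Lemma card_leTP T U (B : set U) : [set: T] #<= B ->
  exists2 f : T -> U, (forall x, B (f x)) & injective f.
Proof.
move=> TB; have [[x0]|nT] := pselect (inhabited T); last first.
  have f (x : T) : U by case: nT.
  by exists f => [x|x]; case: nT.
have [u0 _] : B !=set0.
  apply/set0P/negP => /eqP B0; move: TB; rewrite B0 => /card_le0P T0.
  by have : set0 x0 by rewrite -T0.
have [f fB finj] := card_le_funP u0 TB.
by exists f => [x|x y]; [exact: fB|exact: finj].
Qed.

Lemma card_le_relP T U (A : set T) (B : set U) : A #<= B ->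
  exists2 R : T -> U -> Prop, (forall x, A x -> exists2 y, B y & R x y) &
    forall x x' y, A x -> A x' -> R x y -> R x' y -> x = x'.
Proof.
elim/Ppointed: U => U in B *.
  have -> : B = set0 by rewrite -subset0 => y; case: (no y).
  by move=> /card_le0P A0; rewrite A0; exists (fun _ _ => False).
move/(card_le_funP point) => [f fAB finj]; exists (fun x y => f x = y).
  by move=> x Ax; exists (f x) => //; exact: fAB.
by move=> x x' y Ax Ax' <- /esym; exact: finj.
Qed.

Lemma card_le_setX T U T' U' (A : set T) (B : set U) (A' : set T')
    (B' : set U') : A #<= A' -> B #<= B' -> A `*` B #<= A' `*` B'.
Proof.
move=> /card_le_relP[R RA Ri] /card_le_relP[S SB Si].
apply: (@card_le_rel _ _ _ _ (fun p q => R p.1 q.1 /\ S p.2 q.2)).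
  move=> [x y] [/= /RA[x' Ax' xx'] /SB[y' By' yy']].
  by exists (x', y').
move=> [x y] [x' y'] [z w] [/= Ax By] [/= Ax' By'] _ [xz yw] [xz' yw'].
by congr (_, _); [exact: Ri xz xz'|exact: Si yw yw'].
Qed.

Lemma card_le_set_sum T U T' U' (A : set T) (B : set U) (A' : set T')
    (B' : set U') : A #<= A' -> B #<= B' -> set_sum A B #<= set_sum A' B'.
Proof.
move=> /card_le_relP[R RA Ri] /card_le_relP[S SB Si].
apply: (@card_le_rel _ _ _ _ (fun p q => match p, q with
  | inl x, inl y => R x y | inr x, inr y => S x y | _, _ => False end)).
  by move=> [x /RA[y]|x /SB[y]] yB xy; [exists (inl y)|exists (inr y)].
move=> [x|x] [x'|x'] [y|y] //= Ax Ax' _ xy x'y; congr (_ _).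
  exact: Ri xy x'y.
exact: Si xy x'y.
Qed.

(** Zorn's lemma on graphs of partial injections: a maximal one is defined on all of [A] or reaches
    all of [B], since otherwise one more pair could be added. *)
Lemma card_le_total T U (A : set T) (B : set U) : A #<= B \/ B #<= A.
Proof.
pose P (G : set (T * U)) := [/\ G `<=` A `*` B,
  forall x y y', G (x, y) -> G (x, y') -> y = y' &
  forall x x' y, G (x, y) -> G (x', y) -> x = x'].
have [G [[GAB Gf Gi] Gmax]] : exists G, P G /\ forall G', G `<` G' -> ~ P G'.
  apply: Zorn_bigcup => F FP tF; split.
  - by move=> p [G /FP[GAB _ _] /GAB].
  - move=> x y y' [G FG Gx] [G' FG' Gx'].
    by have [h|h] := tF _ _ FG FG'; [move: (FP _ FG') => -[_ + _]
      |move: (FP _ FG) => -[_ + _]]; apply; eauto.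
  - move=> x x' y [G FG Gx] [G' FG' Gx'].
    by have [h|h] := tF _ _ FG FG'; [move: (FP _ FG') => -[_ _ +]
      |move: (FP _ FG) => -[_ _ +]]; apply; eauto.
have [dA|/existsNP[x /not_implyP[Ax nx]]] :=
    pselect (forall x, A x -> exists y, G (x, y)).
  left; apply: (@card_le_rel _ _ _ _ (fun x y => G (x, y))).
    by move=> x /dA[y Gxy]; exists y => //; case: (GAB _ Gxy).
  by move=> x x' y _ _ _; exact: Gi.
have [dB|/existsNP[y /not_implyP[By ny]]] :=
    pselect (forall y, B y -> exists x, G (x, y)).
  right; apply: (@card_le_rel _ _ _ _ (fun y x => G (x, y))).
    by move=> y /dB[x' Gxy]; exists x' => //; case: (GAB _ Gxy).
  by move=> y y' x' _ _ _; exact: Gf.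
exfalso; apply: (Gmax (G `|` [set (x, y)])).
  split; first by left.
  by move=> /(_ (x, y)) h; apply: nx; exists y; apply: h; right.
split.
- by move=> p [/GAB//|->].
- move=> x1 y1 y2 [G1|[E1 E2]] [G2|[E3 E4]]; subst => //.
  + exact: Gf G1 G2.
  + by case: nx; exists y1.
  + by case: nx; exists y2.
- move=> x1 x2 y1 [G1|[E1 E2]] [G2|[E3 E4]]; subst => //.
  + exact: Gi G1 G2.
  + by case: ny; exists x1.
  + by case: ny; exists x2.
Qed.

Lemma card_le_setU_sum T (A B : set T) : A `|` B #<= set_sum A B.
Proof.
apply: (@card_le_rel _ _ _ _
    (fun x p => match p with inl y => x = y | inr y => x = y end)).
  by move=> x [Ax|Bx]; [exists (inl x)|exists (inr x)].
by move=> x x' [y|y] _ _ _ -> ->.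
Qed.

Lemma set_sum_le_setX T (A : set T) (a b : T) : A a -> A b -> a <> b ->
  set_sum A A #<= A `*` A.
Proof.
move=> Aa Ab ab; apply: (@card_le_fun _ _ _ _
  (fun p => match p with inl x => (a, x) | inr x => (b, x) end)).
  by move=> [].
by move=> [x|x] [y|y] _ _ [] => [->|E|E|->] //; case: ab.
Qed.

Lemma infinite_set_two T (A : set T) : infinite_set A ->
  exists a b, [/\ A a, A b & a <> b].
Proof.
move=> iA; have [a Aa] := infinite_setN0 iA.
have [b Ab ba] : exists2 b, A b & b <> a.
  apply: contrapT => h; apply: iA; apply: (@sub_finite_set _ _ [set a]) => //.
  by move=> b Ab; apply: contrapT => ba; apply: h; exists b.
by exists a, b; split=> //; exact/nesym.
Qed.

(** Zorn's lemma on injections of B x B into B for subsets B of [A]. If a maximal one had |B| < |A|,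
    the complement of B in [A] would contain a copy C of B, and the injection would extend to the
    square of the union of B and C. *)
Lemma infinite_setX_le T (A : set T) : infinite_set A -> A `*` A #<= A.
Proof.
move=> /[dup] iA /infiniteP/card_leTP[e eA einj].
(* A triple (x, y, z) says that the pair (x, y) goes to z; [D G] is the set B. *)
pose D (G : set (T * T * T)) := [set x | exists y z, G (x, y, z)].
pose good (G : set (T * T * T)) := [/\
  forall x y, D G x -> D G y -> exists z, G (x, y, z),
  forall x y z, G (x, y, z) -> [/\ A x, D G y & D G z] &
  forall x y x' y' z, G (x, y, z) -> G (x', y', z) -> x = x' /\ y = y'].
have /card_leTP[p _ pinj] : [set: nat * nat] #<= [set: nat].
  by have := card_nat2; rewrite card_eq_le => /andP[].
pose G0 : set (T * T * T) := [set t | exists m n, t = (e m, e n, e (p (m, n)))].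
have D0 x : D G0 x <-> exists n, x = e n.
  split=> [[y [z [m [n [-> _ _]]]]]|[n ->]]; first by exists m.
  by exists (e 0), (e (p (n, 0))), n, 0.
have good0 : good G0.
  split.
  - by move=> x y /D0[m ->] /D0[n ->]; exists (e (p (m, n))), m, n.
  - move=> x y z [m [n [-> -> ->]]]; split=> //; apply/D0; eexists; reflexivity.
  - by move=> x y x' y' z [m [n [-> -> ->]]] [m' [n' [-> -> /einj/pinj[-> ->]]]].
(* Adding [G0] to every member makes the union of the empty chain good and keeps B infinite. *)
have [M [gM Mmax]] : exists G, good (G `|` G0) /\
    forall G', G `<` G' -> ~ good (G' `|` G0).
  apply: (@Zorn_bigcup _ [set G | good (G `|` G0)]) => F FP tF.
  (* Each clause of [good] involves at most two triples, so it is enough to find any two of them in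
     one good subset of the union. *)
  have cF : forall t u, (\bigcup_(G in F) G `|` G0) t ->
      (\bigcup_(G in F) G `|` G0) u ->
      exists G, [/\ good G, G `<=` \bigcup_(G in F) G `|` G0, G t & G u].
    have sub G : F G -> G `|` G0 `<=` \bigcup_(G in F) G `|` G0.
      by move=> FG t [Gt|?]; [left; exists G|right].
    move=> t u [[G FG Gt]|G0t] [[G' FG' Gu]|G0u]; last first.
    - by exists G0; split=> // ? ?; right.
    - by exists (G' `|` G0); split; [exact: FP|exact: sub|right|left].
    - by exists (G `|` G0); split; [exact: FP|exact: sub|left|right].
    - have [GG|GG] := tF _ _ FG FG'.
        by exists (G' `|` G0); split; [exact: FP|exact: sub|left; apply: GG|left].
      by exists (G `|` G0); split; [exact: FP|exact: sub|left|left; apply: GG].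
  set H := _ `|` G0 in cF *; rewrite /= -/H.
  split.
  - move=> x y [x1 [x2 Hx]] [y1 [y2 Hy]].
    have [G [[Gt _ _] GH Gx Gy]] := cF _ _ Hx Hy.
    have [||z Gz] := Gt x y; [by exists x1, x2|by exists y1, y2|].
    by exists z; apply: GH.
  - move=> x y z Hx; have [G [[_ Gd _] GH Gx _]] := cF _ _ Hx Hx.
    have [Ax [y1 [y2 Gy]] [z1 [z2 Gz]]] := Gd _ _ _ Gx.
    by split=> //; [exists y1, y2|exists z1, z2]; apply: GH.
  - move=> x y x' y' z Hx Hx'; have [G [[_ _ Gi] GH Gx Gx']] := cF _ _ Hx Hx'.
    exact: Gi Gx Gx'.
set N := M `|` G0 in gM; have [Nt Nd Ni] := gM; set B := D N.
have BA : B `<=` A by move=> x [y [z /Nd[]]].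
have BBB : B `*` B #<= B.
  apply: (@card_le_rel _ _ _ _ (fun p z => N (p.1, p.2, z))).
    move=> [x y] [/= Bx By]; have [z Nz] := Nt _ _ Bx By; exists z => //.
    by have [] := Nd _ _ _ Nz.
  by move=> [x y] [x' y'] z _ _ _ /= h /(Ni _ _ _ _ _ h)[-> ->].
have Be n : B (e n) by have /D0[y [z h]] : exists m, e n = e m by [exists n];
  exists y, z; right.
have BS : set_sum B B #<= B.
  apply: card_le_trans BBB; apply: (@set_sum_le_setX _ _ (e 0) (e 1)) => //.
  by move=> /einj.
have [AB|nAB] := pselect (A #<= B).
  apply: card_le_trans (card_le_setX AB AB) _; apply: card_le_trans BBB _.
  exact: subset_card_le.
have [AD|BD] := card_le_total (A `\` B) B.
  exfalso; apply: nAB; have -> : A = (A `\` B) `|` B.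
    apply/seteqP; split=> [x Ax|x [[]//|/BA//]].
    by have [?|?] := pselect (B x); [right|left].
  apply: card_le_trans (card_le_setU_sum _ _) _.
  by apply: card_le_trans BS; apply: card_le_set_sum.
have [c cAB cinj] := card_le_funP (e 0) BD.
pose C := c @` B; pose E := B `|` C.
have CB : C #<= B by exact: card_image_le.
have EB : E #<= B.
  apply: card_le_trans (card_le_setU_sum _ _) _.
  by apply: card_le_trans BS; apply: card_le_set_sum.
have [g gB ginj] := card_le_funP (e 0)
  (card_le_trans (card_le_setX EB EB) BBB).
have CnB x : C x -> ~ B x by move=> [y By <-]; case: (cAB _ By).
have CA x : C x -> A x by move=> [y By <-]; case: (cAB _ By).
exfalso.
(* The new pairs are coded in B by [g] and then moved by [c] into C, away from the old values. *)
pose M' := M `|` [set t | [/\ E t.1.1, E t.1.2, ~ (B t.1.1 /\ B t.1.2) &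
  t.2 = c (g t.1)]].
have DM' x : D (M' `|` G0) x <-> E x.
  split=> [[y [z [[Mx|[] //]|G0x]]]|[Bx|Cx]].
  - by left; exists y, z; left.
  - by left; exists y, z; right.
  - by move: Bx => [y [z [?|?]]]; exists y, z; [left; left|right].
  - exists x, (c (g (x, x))); left; right; split=> //=; [by right|by right|].
    by move=> [Bx]; case: (CnB _ Cx).
have NM' : N `<=` M' `|` G0 by move=> t [?|?]; [left; left|right].
have M'N t : (M' `|` G0) t -> N t \/ [/\ E t.1.1, E t.1.2,
    ~ (B t.1.1 /\ B t.1.2) & t.2 = c (g t.1)].
  by move=> [[?|?]|?]; [left; left|right|left; right].
apply: (Mmax M').
  split; first by move=> t; left.
  pose x := c (e 0); have Cx : C x by exists (e 0).
  move=> /(_ (x, e 0, c (g (x, e 0)))) h.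
  have /h Mx : M' (x, e 0, c (g (x, e 0))).
    by right; split=> //=; [right|left|move=> [/(CnB _ Cx)]].
  by apply: (CnB _ Cx); exists (e 0), (c (g (x, e 0))); left.
split.
- move=> x y /DM' Ex /DM' Ey.
  have [[Bx By]|nB] := pselect (B x /\ B y).
    by have [z Nz] := Nt _ _ Bx By; exists z; apply: NM'.
  by exists (c (g (x, y))); left; right.
- move=> x y z /M'N[/Nd[Ax By Bz]|/= [Ex Ey nB ->]].
    by split=> //; apply/DM'; left.
  split; [by case: Ex => [/BA|/CA]|exact/DM'|].
  by apply/DM'; right; exists (g (x, y)) => //; apply: gB.
- move=> x y x' y' z /M'N[Nx|/= [Ex Ey nB zE]] /M'N[Nx'|/= [Ex' Ey' nB' zE']].
  + exact: Ni Nx Nx'.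
  + have [_ _ Bz] := Nd _ _ _ Nx.
    by exfalso; apply: CnB Bz; rewrite zE'; exists (g (x', y')) => //; apply: gB.
  + have [_ _ Bz] := Nd _ _ _ Nx'.
    by exfalso; apply: CnB Bz; rewrite zE; exists (g (x, y)) => //; apply: gB.
  + have gg : g (x, y) = g (x', y').
      by apply: cinj; [exact: gB|exact: gB|rewrite -zE -zE'].
    by have [] := ginj (x, y) (x', y') (conj Ex Ey) (conj Ex' Ey') gg.
Qed.

Lemma infinite_set_sum_le T U V (A : set T) (B : set U) (C : set V) :
  infinite_set C -> A #<= C -> B #<= C -> set_sum A B #<= C.
Proof.
move=> iC leAC leBC; apply: card_le_trans (card_le_set_sum leAC leBC) _.
have [a [b [Ca Cb ab]]] := infinite_set_two iC.
exact: card_le_trans (set_sum_le_setX Ca Cb ab) (infinite_setX_le iC).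
Qed.

Lemma infinite_setU_le T V (A B : set T) (C : set V) :
  infinite_set C -> A #<= C -> B #<= C -> A `|` B #<= C.
Proof.
move=> iC leAC leBC; apply: card_le_trans (card_le_setU_sum _ _) _.
exact: infinite_set_sum_le.
Qed.

Lemma infinite_le_setU T V (A B : set T) (C : set V) :
  infinite_set C -> C #<= A `|` B -> C #<= A \/ C #<= B.
Proof.
move=> iC.
wlog AB : A B / A #<= B.
  move=> h CAB; have [AB|BA] := card_le_total A B; first exact: h.
  by rewrite setUC in CAB; have [] := h _ _ BA CAB; [right|left].
move=> CAB; have [fB|iB] := pselect (finite_set B).
  exfalso; apply: iC; apply: card_le_finite CAB _.
  by rewrite finite_setU; split=> //; apply: card_le_finite AB fB.
right; apply: card_le_trans CAB _; exact: infinite_setU_le.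
Qed.

Lemma infinite_le_set_sum T U V (A : set T) (B : set U) (C : set V) :
  infinite_set C -> C #<= set_sum A B -> C #<= A \/ C #<= B.
Proof.
move=> iC CAB; have [] : C #<= @inl T U @` A \/ C #<= @inr T U @` B.
- apply: infinite_le_setU => //; apply: card_le_trans CAB _.
  by apply: subset_card_le => -[x|x] /= ?; [left|right]; exists x.
- by move=> h; left; apply: card_le_trans h (card_image_le _ _).
- by move=> h; right; apply: card_le_trans h (card_image_le _ _).
Qed.

Lemma bigcup_le_setX I J T (D : set I) (F : I -> set T) (E : set J) :
  (forall i, D i -> F i #<= E) -> \bigcup_(i in D) F i #<= D `*` E.
Proof.
move=> FE.
have /choice[R RP] i : exists R : T -> J -> Prop, D i ->
    (forall x, F i x -> exists2 y, E y & R x y) /\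
    forall x x' y, F i x -> F i x' -> R x y -> R x' y -> x = x'.
  have [Di|?] := pselect (D i); last by exists (fun _ _ => True).
  by have /card_le_relP[R ? ?] := FE i Di; exists R.
apply: (@card_le_rel _ _ _ _ (fun x p => F p.1 x /\ R p.1 x p.2)).
  move=> x [i Di Fx]; have [/(_ _ Fx)[y Ey xy] _] := RP i Di.
  by exists (i, y).
move=> x x' [i j] _ _ [/= Di Ej] [Fx xj] [Fx' xj'].
by have [_ h] := RP i Di; exact: h xj xj'.
Qed.

Lemma bigcup_infinite_le I V T (D : set I) (F : I -> set T) (C : set V) :
  infinite_set C -> D #<= C -> (forall i, D i -> F i #<= C) ->
  \bigcup_(i in D) F i #<= C.
Proof.
move=> iC DC FC; apply: card_le_trans (bigcup_le_setX FC) _.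
exact: card_le_trans (card_le_setX DC (card_lexx C)) (infinite_setX_le iC).
Qed.

(** The union embeds in the product of [D] and [E], and a product with an infinite factor is no
    larger than its larger factor. *)
Lemma infinite_le_bigcup I J V T (D : set I) (F : I -> set T) (E : set J)
    (C : set V) : infinite_set C -> (forall i, D i -> F i #<= E) ->
  C #<= \bigcup_(i in D) F i -> C #<= D \/ C #<= E.
Proof.
move=> iC FE /card_le_trans/(_ (bigcup_le_setX FE)) CDE.
have [DE|ED] := card_le_total D E.
  have [fE|iE] := pselect (finite_set E).
    exfalso; apply: iC; apply: card_le_finite CDE _.
    by apply: finite_setX => //; exact: card_le_finite DE fE.
  right; apply: card_le_trans CDE _; apply: card_le_trans (infinite_setX_le iE).
  exact: card_le_setX.
have [fD|iD] := pselect (finite_set D).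
  exfalso; apply: iC; apply: card_le_finite CDE _.
  by apply: finite_setX => //; exact: card_le_finite ED fD.
left; apply: card_le_trans CDE _; apply: card_le_trans (infinite_setX_le iD).
exact: card_le_setX.
Qed.

(** * Kernels, duality and generation *)

Section Kernels.
Context {X : Type}.
Implicit Types (a b : partmon X) (u v w : X + X) (U V : set (X + X)).

Definition block_of a u : set (X + X) := [set v | same_block a u v].

Lemma block_of_refl a u : block_of a u u.
Proof. exact: same_block_refl. Qed.

Lemma blocks_of a u : blocks a (block_of a u).
Proof. by apply/blocksE; exists u. Qed.

Lemma block_ofE a U u : blocks a U -> U u -> U = block_of a u.
Proof. by move=> aU Uu; apply: block_inj aU (blocks_of a u) Uu _; exact: block_of_refl. Qed.

Lemma block_of_eq a u v : block_of a u = block_of a v <-> same_block a u v.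
Proof.
split=> [uv|uv]; first by have := block_of_refl a v; rewrite -uv.
by rewrite (block_ofE (blocks_of a u) uv).
Qed.

(** Presenting a partition by the fibres of a map turns membership in a common block into an
    equation. *)
Definition kernel K (key : X + X -> K) : partmon X :=
  @partmon_of_rel X (fun u v => key u = key v) (fun=> erefl)
    (fun _ _ => @esym _ _ _) (fun _ _ _ => @etrans _ _ _ _).

Lemma same_block_kernel K (key : X + X -> K) u v :
  same_block (kernel key) u v <-> key u = key v.
Proof. exact: same_block_of_rel. Qed.

(** A component is bounded from above by a property that no edge leaves; vertices are shown not to
    be joined in this way. *)
Lemma joined_closed a b (P : vertex -> Prop) p q :
  (forall u v, same_block a u v -> P (relabel_low u) -> P (relabel_low v)) ->
  (forall u v, same_block b u v -> P (relabel_up u) -> P (relabel_up v)) ->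
  joined a b p q -> P p -> P q.
Proof.
move=> Pa Pb; elim=> [_ _ [u v|u v]|//|r s t _ rs _ st /rs//].
  exact: Pa.
exact: Pb.
Qed.

Lemma joined_key a b K (key : vertex -> K) p q :
  (forall u v, same_block a u v -> key (relabel_low u) = key (relabel_low v)) ->
  (forall u v, same_block b u v -> key (relabel_up u) = key (relabel_up v)) ->
  joined a b p q -> key p = key q.
Proof.
move=> Ka Kb /(@joined_closed _ _ (fun r => key p = key r)); apply => //.
  by move=> u v /Ka <-.
by move=> u v /Kb <-.
Qed.

Lemma joined_low a b u v : same_block a u v ->
  joined a b (relabel_low u) (relabel_low v).
Proof. by move=> uv; apply: rt_step; left. Qed.

Lemma joined_up a b u v : same_block b u v ->
  joined a b (relabel_up u) (relabel_up v).
Proof. by move=> uv; apply: rt_step; right. Qed.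

Definition swap u : X + X :=
  match u with inl x => inr x | inr x => inl x end.

Lemma swapK : involutive swap. Proof. by case. Qed.

(** The anti-involution that exchanges L_X with R_X and upper with lower counts, so that a result
    about one side serves both. *)
Definition flip a : partmon X := kernel (fun u => block_of a (swap u)).

Lemma same_block_flip a u v :
  same_block (flip a) u v <-> same_block a (swap u) (swap v).
Proof. by rewrite same_block_kernel block_of_eq. Qed.

Lemma flipK : involutive flip.
Proof.
by move=> a; apply: partmon_eq => u v; rewrite !same_block_flip !swapK.
Qed.

Lemma flipM a b : flip (a * b)%g = (flip b * flip a)%g.
Proof.
pose f (p : @vertex X) :=
  match p with Up x => Low x | Mid x => Mid x | Low x => Up x end.
have h c d p q : joined c d p q -> joined (flip d) (flip c) (f p) (f q).
  elim=> [_ _ [w z wz|w z wz]|r|r s t _ rs _ st].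
  - have /(joined_up (flip d)) : same_block (flip c) (swap w) (swap z).
      by rewrite same_block_flip !swapK.
    by case: w z wz => ? [].
  - have /(@joined_low _ (flip c)) : same_block (flip d) (swap w) (swap z).
      by rewrite same_block_flip !swapK.
    by case: w z wz => ? [].
  - exact: rt_refl.
  - exact: rt_trans rs st.
apply: partmon_eq => u v; rewrite same_block_flip !same_block_mul.
by split=> /h; rewrite ?flipK; case: u v => ? [].
Qed.

Lemma flip1 : flip 1%g = 1%g.
Proof.
by apply: partmon_eq => u v; rewrite same_block_flip !same_block_one; case: u v => ? [].
Qed.

Lemma sym_grp_flip a : sym_grp a -> sym_grp (flip a).
Proof. by move=> [b [ab ba]]; exists (flip b); rewrite -!flipM ab ba flip1. Qed.

(** For bijective [h] this is the unit with the blocks {x, h(x)'}. *)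
Definition perm (h : X -> X) : partmon X :=
  kernel (fun u => match u with inl x => h x | inr y => y end).

Definition on_upper (h : X -> X) u : X + X :=
  match u with inl x => inl (h x) | inr y => inr y end.

(** Each upper vertex x is tied to the middle vertex h x, so a left factor [perm h] only renames the
    upper vertices of [b]. *)
Lemma same_block_permM h b u v : same_block (perm h * b)%g u v <->
  same_block b (on_upper h u) (on_upper h v).
Proof.
rewrite same_block_mul.
pose key (p : @vertex X) := match p with
  | Up x => block_of b (inl (h x)) | Mid x => block_of b (inl x)
  | Low x => block_of b (inr x) end.
have ko w : key (outer w) = block_of b (on_upper h w) by case: w.
split.
  rewrite -block_of_eq -!ko; apply: joined_key => w z.
    by move=> /same_block_kernel; case: w z => x [y|y] /= ->.
  by move=> /block_of_eq; case: w z => x [].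
have j w : joined (perm h) b (outer w) (relabel_up (on_upper h w)).
  case: w => x; last exact: rt_refl.
  by apply: (@joined_low _ _ (inl x) (inr (h x))); apply/same_block_kernel.
move=> /(joined_up (perm h)) uv.
exact: rt_trans (j u) (rt_trans _ _ _ _ _ uv (joined_sym (j v))).
Qed.

Lemma sym_grp_perm h : bijective h -> sym_grp (perm h).
Proof.
move=> [g hK gK]; exists (perm g).
by split; apply: partmon_eq => u v;
  rewrite same_block_permM same_block_kernel same_block_one;
  case: u v => x [y|y] /=; rewrite ?hK ?gK; split=> // ->; rewrite ?hK ?gK.
Qed.

Lemma in_LP a : in_L a <->
  (forall x, exists y, same_block a (inl x) (inr y)) /\
  (forall x y, same_block a (inl x) (inl y) -> x = y).
Proof.
split=> [[aT aI]|[aT aI]]; split.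
- by move=> x; have [U aU [Ux [w Uw]]] := aT x; exists w, U.
- by move=> x y [U aU [Ux Uy]]; exact: aI aU Ux Uy.
- by move=> x; have [w [U aU [Ux Uw]]] := aT x; exists U => //; split=> //; exists w.
- by move=> U x y aU Ux Uy; apply: aI; exists U.
Qed.

Lemma in_RP a : in_R a <->
  (forall y, exists x, same_block a (inr y) (inl x)) /\
  (forall x y, same_block a (inr x) (inr y) -> x = y).
Proof.
split=> [[aT aI]|[aT aI]]; split.
- by move=> x; have [U aU [Ux [w Uw]]] := aT x; exists w, U.
- by move=> x y [U aU [Ux Uy]]; exact: aI aU Ux Uy.
- by move=> x; have [w [U aU [Ux Uw]]] := aT x; exists U => //; split=> //; exists w.
- by move=> U x y aU Ux Uy; apply: aI; exists U.
Qed.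

Lemma in_L_flip a : in_L (flip a) <-> in_R a.
Proof.
rewrite in_LP in_RP; split=> -[aT aI]; split.
- by move=> x; have [w /same_block_flip] := aT x; exists w.
- by move=> x y xy; apply: aI; apply/same_block_flip.
- by move=> x; have [w] := aT x; exists w; apply/same_block_flip.
- by move=> x y /same_block_flip; apply: aI.
Qed.

Lemma in_R_flip a : in_R (flip a) <-> in_L a.
Proof. by rewrite -in_L_flip flipK. Qed.

Lemma in_L_mul a b : in_L a -> in_L b -> in_L (a * b)%g.
Proof.
move=> /in_LP[aT aI] /in_LP[bT bI]; apply/in_LP; split.
  move=> x; have [y xy] := aT x; have [z yz] := bT y; exists z.
  rewrite same_block_mul; apply: rt_trans (joined_low b xy) _.
  exact: (joined_up a yz).
move=> x y /same_block_mul /=.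
(* The component of the upper vertex x runs straight down: its block in [a], then the blocks of [b]
   below the lower points of that block. *)
pose P (p : vertex) := match p with
  | Up z => z = x | Mid m => same_block a (inl x) (inr m)
  | Low z => exists2 m, same_block a (inl x) (inr m)
                      & same_block b (inl m) (inr z) end.
move=> /(@joined_closed _ _ P); move=> h; symmetry; apply: h => //.
  move=> [u|u] [v|v] uv /=.
  - by move=> ux; apply/esym/aI; rewrite -ux.
  - by move=> <-.
  - by move=> xu; apply/esym/aI; apply: same_block_trans xu uv.
  - by move=> xu; exact: same_block_trans xu uv.
move=> [u|u] [v|v] uv /=.
- by rewrite -(bI _ _ uv).
- by move=> xu; exists u.
- move=> [m xm mu]; have <- // : m = v.
  by apply: bI; exact: same_block_trans mu uv.
- by move=> [m xm mu]; exists m => //; exact: same_block_trans mu uv.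
Qed.

(** Both defects of a left factor survive in the product: upper points joined in [a] stay joined,
    and a block of [a] without lower points is a full component. Hence the complement of L_X is a
    right ideal. *)
Lemma in_L_factor a b : in_L (a * b)%g -> in_L a.
Proof.
move=> /in_LP[abT abI]; apply/in_LP; split=> [x|x y xy]; last first.
  by apply: abI; apply/same_block_mul; exact: (joined_low b xy).
apply: contrapT => nx; have [w /same_block_mul] := abT x.
pose P (p : vertex) := if p is Up z then same_block a (inl x) (inl z) else False.
move=> /(@joined_closed _ _ P); apply => /=.
- move=> [u|u] [v|v] //= uv xu; first exact: same_block_trans xu uv.
  by apply: nx; exists v; exact: same_block_trans xu uv.
- by move=> [u|u] [v|v].
- exact: same_block_refl.
Qed.

Lemma sym_grp_in_L a : sym_grp a -> in_L a.
Proof.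
move=> /sym_grpP h; apply/in_LP; split.
  move=> x; have [z [y E]] := h _ (blocks_of a (inl x)).
  have : block_of a (inl x) (inr y) by rewrite E; right.
  by exists y.
move=> x y xy; have [z [t E]] := h _ (blocks_of a (inl x)).
have : block_of a (inl x) (inl x) by exact: block_of_refl.
have : block_of a (inl x) (inl y) by [].
by rewrite E => -[[->]|//] [[->]|//].
Qed.

Lemma sym_grp_in_R a : sym_grp a -> in_R a.
Proof. by move=> /sym_grp_flip/sym_grp_in_L; rewrite in_L_flip. Qed.

Lemma in_LR_sym_grp a : in_L a -> in_R a -> sym_grp a.
Proof.
move=> /in_LP[LT LI] /in_RP[RT RI]; apply/sym_grpP => U aU.
have [x Ux] : exists x, U (inl x).
  have [[x|w] Uw] := block_nonempty aU; first by exists x.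
  have [x [V aV [Vw Vx]]] := RT w.
  by exists x; rewrite (block_inj aU aV Uw Vw).
have [y [V aV [Vx Vy]]] := LT x.
have {V aV Vx Vy} Uy : U (inr y) by rewrite (block_inj aU aV Ux Vx).
exists x, y; apply/seteqP; split=> [[z|z] Uz|z [] -> //].
  by left; congr inl; apply: LI; exists U.
by right; congr inr; apply: RI; exists U.
Qed.

Definition generated (alpha beta : partmon X) : set (partmon X) :=
  subsemigroup_gen (@sym_grp X `|` [set alpha; beta]).

Lemma generated_ind alpha beta (H : set (partmon X)) :
  (forall a b, H a -> H b -> H (a * b)%g) -> @sym_grp X `<=` H ->
  H alpha -> H beta -> generated alpha beta `<=` H.
Proof.
move=> HM HS Ha Hb; apply: smallest_sub; first exact: HM.
by move=> a [/HS//|[] ->].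
Qed.

Lemma generated_mul alpha beta a b : generated alpha beta a ->
  generated alpha beta b -> generated alpha beta (a * b)%g.
Proof. by move=> ga gb M h; case: (h) => MM _; apply: MM; [exact: ga|exact: gb]. Qed.

Lemma generated_sym_grp alpha beta a : sym_grp a -> generated alpha beta a.
Proof. by move=> Sa; apply: sub_gen_smallest; left. Qed.

Lemma generated_l alpha beta : generated alpha beta alpha.
Proof. by apply: sub_gen_smallest; right; left. Qed.

Lemma generated_r alpha beta : generated alpha beta beta.
Proof. by apply: sub_gen_smallest; right; right. Qed.

Lemma generatedC alpha beta : generated alpha beta = generated beta alpha.
Proof. by rewrite /generated [X in _ `|` X]setUC. Qed.

Lemma generated_flip alpha beta a : generated alpha beta a ->
  generated (flip alpha) (flip beta) (flip a).
Proof.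
move: a; apply: generated_ind => [a b ? ?|a /sym_grp_flip||].
- by rewrite flipM; exact: generated_mul.
- exact: generated_sym_grp.
- exact: generated_l.
- exact: generated_r.
Qed.

End Kernels.

(** * Colour-preserving bijections and rearrangements of blocks *)

Lemma inj_surj_bij T U (f : T -> U) :
  injective f -> (forall y, exists x, f x = y) -> bijective f.
Proof. by move=> fi /choice[g gK]; exists g => // x; apply: fi. Qed.

(** The pointwise description of [h] is what later transfers colours and prescribed values from [f]
    and [g] to the bijection. *)
Lemma schroeder_bernstein T U (f : T -> U) (g : U -> T) :
  injective f -> injective g ->
  exists2 h : T -> U, bijective h & forall x, h x = f x \/ g (h x) = x.
Proof.
(* [D] collects the points whose backward orbit ends outside the range of [g]: there [h] follows
   [f], elsewhere it inverts [g]. *)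
move=> fi gi; pose C := fix C n := if n is n.+1 then [set g (f x) | x in C n]
  else ~` range g.
pose D := \bigcup_n C n.
have /choice[h hP] x : exists y, D x /\ y = f x \/ ~ D x /\ g y = x.
  have [Dx|nDx] := pselect (D x); first by exists (f x); left.
  have [y _ yx] : range g x by apply: contrapT => gx; apply: nDx; exists 0.
  by exists y; right.
have Dgf x : D x -> D (g (f x)) by move=> [n _ Cx]; exists n.+1 => //; exists x.
exists h => [|x]; last by case: (hP x) => -[_ ->]; [left|right].
apply: inj_surj_bij => [x x'|y].
  case: (hP x) (hP x') => -[Dx hx] [] [Dx' hx'] E.
  - by apply: fi; rewrite -hx -hx'.
  - by case: Dx'; rewrite -hx' -E hx; exact: Dgf.
  - by case: Dx; rewrite -hx E hx'; exact: Dgf.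
  - by rewrite -hx E.
case: (hP (g y)) => -[Dgy hgy]; last by exists (g y); exact: gi.
case: Dgy => -[|n] _ /=; first by case; exists y.
move=> [x Cx /gi fxy]; exists x; case: (hP x) => -[Dx hx]; first by rewrite hx.
by case: Dx; exists n.
Qed.

(* The bijection is obtained by the Schroeder-Bernstein argument from two injections:
   one follows the partial matching and uses [jr] elsewhere, the other is [jl]. *)
Lemma matching_extension X Q T (q q' : X -> Q) (dom : set T) (pl pr : T -> X)
    (jl jr : Q -> X -> X) :
  (forall s t, dom s -> dom t -> pl s = pl t -> s = t) ->
  (forall s t, dom s -> dom t -> pr s = pr t -> s = t) ->
  (forall t, dom t -> q (pl t) = q' (pr t)) ->
  (forall c, injective (jl c)) -> (forall c, injective (jr c)) ->
  (forall c x, q (jl c x) = c) -> (forall c x, q' (jr c x) = c) ->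
  (forall c x t, dom t -> jl c x <> pl t) ->
  (forall c x t, dom t -> jr c x <> pr t) ->
  exists h, [/\ bijective h, forall x, q' (h x) = q x &
    forall t, dom t -> h (pl t) = pr t].
Proof.
move=> pli pri plr jli jri qjl qjr jlP jrP.
have /choice[f fP] x : exists y, (exists t, [/\ dom t, pl t = x & pr t = y]) \/
    (forall t, dom t -> pl t <> x) /\ y = jr (q x) x.
  have [[t dt tx]|nx] := pselect (exists2 t, dom t & pl t = x).
    by exists (pr t); left; exists t.
  by exists (jr (q x) x); right; split=> // t dt tx; apply: nx; exists t.
have fpl t : dom t -> f (pl t) = pr t.
  move=> dt; case: (fP (pl t)) => [[s [ds /pli st <-]]|[/(_ t dt)//]].
  by rewrite st.
have qf x : q' (f x) = q x.
  by case: (fP x) => [[t [dt <- <-]]|[_ ->]]; [rewrite plr|rewrite qjr].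
have fi : injective f.
  move=> x y fxy.
  have: q x = q y by rewrite -!qf fxy.
  case: (fP x) (fP y) => [[s [ds sx fx]]|[_ fx]] [[t [dt ty fy]]|[_ fy]] qxy.
  - by rewrite -sx -ty; congr pl; apply: pri => //; rewrite fx fy.
  - by case: (jrP (q y) y s ds); rewrite fx -fy.
  - by case: (jrP (q x) x t dt); rewrite fy -fx.
  - by move: fxy; rewrite fx fy qxy; exact: jri.
have gi : injective (fun x => jl (q' x) x).
  by move=> x y E; have := congr1 q E; rewrite !qjl => qq; move: E; rewrite qq => /jli.
have [h hbij hP] := schroeder_bernstein fi gi.
exists h; split=> // [x|t dt].
  by case: (hP x) => [->//|E]; rewrite -[in RHS]E qjl.
by case: (hP (pl t)) => [->|/jlP]; [exact: fpl|case].
Qed.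

(** * Making large blocks nontransversal, and disjoint groups of blocks *)

Section Infinite.
Context {X : Type}.
Hypothesis X_infinite : infinite_set [set: X].
Implicit Types (a b : partmon X) (U : set (X + X)).

Lemma infinite_sum_inj : exists e : X + X -> X, injective e.
Proof.
have /card_leTP[e _ ei] : [set: X + X] #<= [set: X]; last by exists e.
apply: card_le_trans
  (infinite_set_sum_le X_infinite (card_lexx [set: X]) (card_lexx [set: X])).
by apply: subset_card_le => -[].
Qed.

Lemma infinite_prod_inj : exists e : X * X -> X, injective e.
Proof.
have /card_leTP[e _ ei] : [set: X * X] #<= [set: X]; last by exists e.
by apply: card_le_trans (infinite_setX_le X_infinite); apply: subset_card_le.
Qed.

Lemma infinite_split : exists Z : set X, [set: X] #<= Z /\ [set: X] #<= ~` Z.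
Proof.
have [e ei] := infinite_sum_inj; exists [set x | exists y, x = e (inl y)].
split; [apply: (@card_le_fun _ _ _ _ (e \o inl))
       |apply: (@card_le_fun _ _ _ _ (e \o inr))] => /=.
- by move=> x _; exists x.
- by move=> x y _ _ /ei[].
- by move=> x _ [y /ei].
- by move=> x y _ _ /ei[].
Qed.

(** One alternative is chosen for all cardinals at once: if P fails at i, then Q holds at i, and
    comparing i with j either carries Q from i to j or makes P fail at j. *)
Lemma chain_dichotomy I (P Q : I -> Prop) : (forall i, P i \/ Q i) ->
  (forall i j, (P i -> P j) /\ (Q i -> Q j) \/ (P j -> P i) /\ (Q j -> Q i)) ->
  (forall i, P i) \/ (forall i, Q i).
Proof.
move=> PQ ch; have [|/existsNP[i nPi]] := pselect (forall i, P i); first by left.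
right=> j; case: (ch i j) => -[Pij Qij]; first by case: (PQ i) => // /Qij.
by case: (PQ j) => // /Pij.
Qed.

Lemma low_points a (P : set X -> Prop) : (forall A, P A -> A !=set0) ->
  [set: X] #<= [set U | [/\ blocks a U, upper U = set0 & P (lower U)]] ->
  exists d : X -> X, [/\ forall x y, ~ same_block a (inl x) (inr (d y)),
    forall x y, same_block a (inr (d x)) (inr (d y)) -> x = y &
    forall x, P (lower (block_of a (inr (d x))))].
Proof.
move=> P0 /card_leTP[V VP Vi].
have /choice[d dV] x : exists y, V x (inr y).
  by have [_ _ /P0[y Vy]] := VP x; exists y.
have Vd x : V x = block_of a (inr (d x)).
  by have [aV _ _] := VP x; exact: block_ofE.
exists d; split=> [x y xy|x y|x].
- have [_ V0 _] := VP y; have : upper (V y) x by rewrite Vd; exact: same_block_sym.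
  by rewrite V0.
- by move=> /block_of_eq; rewrite -!Vd; exact: Vi.
- by rewrite -Vd; have [] := VP x.
Qed.

Lemma in_L_points a : in_L a -> exists2 m : X -> X,
  forall x, same_block a (inl x) (inr (m x)) & injective m.
Proof.
move=> /in_LP[/choice[m mP] aI]; exists m => // x y mxy.
apply: aI; apply: same_block_trans (mP x) _; rewrite mxy.
exact: same_block_sym (mP y).
Qed.

Lemma transversal_to_low a (Z : set X) : in_L a ->
  [set: X] #<= ~` Z ->
  [set: X] #<= [set U | [/\ blocks a U, upper U = set0 & lower U !=set0]] ->
  exists b, [/\ forall c, generated a c b, in_L b &
    forall P : set X -> Prop, (forall A B, A `<=` B -> P A -> P B) ->
    Z `&` [set x | P (lower (block_of a (inl x)))] #<=
      [set U | [/\ blocks b U, upper U = set0 & P (lower U)]]].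
Proof.
move=> La /card_leTP[z zZ zi] /low_points[//|d [dN di _]].
have [aT aI] := (in_LP a).1 La; have [m mP mi] := in_L_points La.
(* There is only one colour here. The lower points [m x] of transversal blocks avoid [d], and [z]
   lands outside [Z], so both give the room required. *)
have [h [hb _ hd]] : exists h, [/\ bijective h,
    forall x : X, tt = tt & forall t, Z t -> h (d t) = t].
  apply: (@matching_extension X unit X (fun=> tt) (fun=> tt) Z d id
    (fun=> m) (fun=> z)) => //.
  - by move=> x y _ _ dxy; apply: di; rewrite dxy; exact: same_block_refl.
  - by move=> [].
  - by move=> [].
  - by move=> _ x t _ mx; apply: (dN x t); rewrite -mx.
  - by move=> _ x t Zt zx; apply: (zZ x); rewrite zx.
exists (a * (perm h * a))%g; split.
- move=> c; apply: generated_mul; first exact: generated_l.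
  apply: generated_mul; last exact: generated_l.
  by apply: generated_sym_grp; exact: sym_grp_perm.
- apply: (in_L_mul La); apply: (in_L_mul _ La); apply: sym_grp_in_L.
  exact: sym_grp_perm.
move=> P Pmono; set b := (a * _)%g.
(* Contains the component of the middle point [d y] and no upper vertex. *)
pose R y (p : vertex) := match p with
  | Up _ => False
  | Mid x => same_block a (inr x) (inr (d y))
  | Low w => exists2 x, same_block a (inr x) (inr (d y))
                      & same_block a (inl (h x)) (inr w) end.
have Rclosed y p p' : joined a (perm h * a)%g p p' -> R y p -> R y p'.
  apply: joined_closed.
    move=> [u|u] [v|v] uv //= uy; last exact: same_block_trans (same_block_sym uv) uy.
    by apply: (dN v y); exact: same_block_trans (same_block_sym uv) uy.
  move=> [u|u] [v|v] /same_block_permM uv /=.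
  - have /(bij_inj hb) <- // : h u = h v by exact: aI.
  - by move=> uy; exists u.
  - move=> [x xy xu]; have /(bij_inj hb) <- // : h x = h v.
    by apply: aI; exact: same_block_trans xu uv.
  - by move=> [x xy xu]; exists x => //; exact: same_block_trans xu uv.
have R0 y w : Z y -> same_block a (inl y) (inr w) -> R y (Low w).
  by move=> Zy yw; exists (d y); [exact: same_block_refl|rewrite hd].
apply: (@card_le_rel _ _ _ _ (fun y U =>
    exists2 w, same_block a (inl y) (inr w) & U (inr w))).
  move=> y [Zy Py]; have [w yw] := aT y; exists (block_of b (inr w)); last first.
    by exists w => //; exact: block_of_refl.
  split; first exact: blocks_of.
    rewrite -subset0 => x /same_block_mul/(Rclosed y); apply.
    exact: R0.
  apply: Pmono Py => w' yw'; apply/same_block_mul.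
  apply: (@joined_up _ a (perm h * a)%g (inr w) (inr w')).
  by apply/same_block_permM; exact: same_block_trans (same_block_sym yw) yw'.
move=> y y' U [Zy _] [Zy' _] [bU _ _] [w yw Uw] [w' yw' Uw'].
have : same_block b (inr w) (inr w') by exists U.
move=> /same_block_mul/(Rclosed y)/(_ (R0 _ _ Zy yw))[x xy xw'].
have : h x = h (d y').
  by rewrite hd //; apply: aI; apply: same_block_trans xw' (same_block_sym yw').
move=> /(bij_inj hb) E; apply: di; apply: same_block_sym.
by rewrite -E.
Qed.

(** A single product must serve every index. The dichotomy is used twice: to decide between
    transversal and nontransversal blocks, and then between [Z] and its complement as the set of
    upper points to cut off. *)
Lemma chain_low_blocks I (P : I -> set X -> Prop) a : in_L a ->
  [set: X] #<= [set U | [/\ blocks a U, upper U = set0 & lower U !=set0]] ->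
  (forall i A B, A `<=` B -> P i A -> P i B) ->
  (forall i j, P i `<=` P j \/ P j `<=` P i) ->
  (forall i,
    [set: X] #<= [set U | [/\ blocks a U, Defs.transversal U & P i (lower U)]] \/
    [set: X] #<= [set U | [/\ blocks a U, upper U = set0 & P i (lower U)]]) ->
  exists b, [/\ forall c, generated a c b, in_L b & forall i,
    [set: X] #<= [set U | [/\ blocks b U, upper U = set0 & P i (lower U)]]].
Proof.
move=> La da Pmono Pch kd.
have mono V (F G : set V) : F `<=` G -> [set: X] #<= F -> [set: X] #<= G.
  by move=> FG XF; apply: card_le_trans XF (subset_card_le FG).
have [|k|d] := chain_dichotomy kd; last by exists a; split=> // c; exact: generated_l.
  by move=> i j; case: (Pch i j) => ij; [left|right];
    split; apply: mono => U [aU tU /ij PU].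
(* Transversal blocks are counted by their upper points. *)
have big i : [set: X] #<= [set x | P i (lower (block_of a (inl x)))].
  apply: card_le_trans (k i) _.
  apply: (@card_le_rel _ _ _ _ (fun U x => U (inl x))).
    by move=> U [aU [[x Ux] _] PU]; exists x => //=; rewrite -(block_ofE aU Ux).
  by move=> U V x [aU _ _] [aV _ _] _; exact: block_inj aU aV.
have [Z [XZ XnZ]] := infinite_split.
pose B i := [set x | P i (lower (block_of a (inl x)))].
have [||H|H] := @chain_dichotomy I (fun i => [set: X] #<= Z `&` B i)
  (fun i => [set: X] #<= ~` Z `&` B i).
- move=> i; apply: infinite_le_setU => //.
  by rewrite -setIUl setUv setTI; exact: big.
- by move=> i j; case: (Pch i j) => ij; [left|right];
    split; apply: mono => x [Zx /ij].
- have [b [gb Lb bP]] := transversal_to_low La XnZ da.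
  by exists b; split=> // i; exact: card_le_trans (H i) (bP _ (Pmono i)).
- have [|b [gb Lb bP]] := @transversal_to_low _ (~` Z) La _ da.
    by rewrite setCK.
  by exists b; split=> // i; exact: card_le_trans (H i) (bP _ (Pmono i)).
Qed.

(* A group is a small set of blocks that together cover |X| points and each of
   which has room for one point per block of any group.  If a maximal disjoint
   family of groups had fewer than |X| members, their union would be small, and a
   further group could be chosen from the remaining blocks. *)
Lemma disjoint_groups (C : set (set (X + X))) : singular [set: X] ->
  (forall mu : set X, mu #< [set: X] ->
    [set: X] #<= [set U | C U /\ mu #<= upper U]) ->
  exists G : X -> set (set (X + X)), [/\ forall x, G x `<=` C,
    forall x y U, G x U -> G y U -> x = y,
    forall x, [set: X] #<= \bigcup_(U in G x) upper U,
    forall x, ~ ([set: X] #<= G x) &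
    forall x y U, G x U -> G y #<= upper U].
Proof.
move=> [F [[FX XF] FB FU]] Cbig; have [x0 _] := infinite_setN0 X_infinite.
pose good (G : set (set (X + X))) := [/\ G `<=` C, G #<= F,
  [set: X] #<= \bigcup_(U in G) upper U & forall U, G U -> F #<= upper U].
have [E [Egood Etriv Emax]] := ex_maximal_disjoint_subcollection id good.
suff /card_leTP[G GE Gi] : [set: X] #<= E.
  exists G; split=> [x|x y U Gx Gy|x|x XG|x y U GU].
  - by have /Egood[] := GE x.
  - by apply/Gi/Etriv => //; exists U.
  - by have /Egood[] := GE x.
  - by apply: XF; apply: card_le_trans XG _; have /Egood[] := GE x.
  - have /Egood[_ GF _ _] := GE y; apply: card_le_trans GF _.
    by have /Egood[_ _ _] := GE x; apply.
apply: contrapT => nXE; pose used := \bigcup_(G in E) G.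
have nXused : ~ ([set: X] #<= used).
  move=> /(@infinite_le_bigcup _ _ _ _ E id F _ X_infinite)[|//|//].
  by move=> G /Egood[].
have /choice[V VP] (B : set X) : exists U, F B ->
    [/\ C U, B #<= upper U, F #<= upper U & ~ used U].
  have [FB'|?] := pselect (F B); last by exists set0.
  have [f _ fi] := card_le_funP x0 FX; pose F' := f @` F.
  have F'F : F' #<= F by exact: card_image_le.
  have FF' : F #<= F' by apply: (@card_le_fun _ _ _ _ f) => // y Fy; exists y.
  (* [mu] is the larger of |B| and |F|, the latter realised inside X by [F']. *)
  have [mu [muX Bmu Fmu]] : exists mu : set X,
      [/\ mu #< [set: X], B #<= mu & F #<= mu].
    have [BF'|F'B] := card_le_total B F'.
      exists F'; split=> //; split; first exact: card_leT.
      by move=> /card_le_trans/(_ F'F).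
    exists B; split; [exact: FB|exact: card_lexx|exact: card_le_trans FF' F'B].
  apply: contrapT => nU; apply: nXused; apply: card_le_trans (Cbig _ muX) _.
  apply: subset_card_le => U [CU muU]; apply: contrapT => nusedU; apply: nU.
  exists U => _; split=> //; [exact: card_le_trans Bmu muU|].
  exact: card_le_trans Fmu muU.
pose G := V @` F.
have Fne : exists B, F B.
  have : (\bigcup_(B in F) B) x0 by rewrite FU.
  by move=> [B FB' _]; exists B.
have Ggood : good G.
  split.
  - by move=> _ [B /VP[? _ _ _] <-].
  - exact: card_image_le.
  (* Every [B] in [F] is at most as large as the union covered by the group; if that union were
     small, X would be covered by fewer than |X| sets of at most its size. *)
  - apply: contrapT => nX.
    have := card_lexx [set: X]; rewrite -{2}FU.
    move=> /(@infinite_le_bigcup _ _ _ _ F id _ _ X_infinite).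
    move=> /(_ _ (\bigcup_(U in G) upper U))[|//|//] B FB'.
    have [_ BV _ _] := VP _ FB'; apply: card_le_trans BV _.
    apply: subset_card_le; apply: bigcup_sup; first by exists B.
  - by move=> _ [B /VP[_ _ ? _] <-].
have GnE U : G U -> ~ used U by move=> [B /VP[_ _ _ ?] <-].
apply: (Emax (E `|` [set G])).
- split; first by left.
  move=> /(_ G (or_intror erefl)) EG; have [B FB'] := Fne.
  by apply: (GnE (V B)); [exists B|exists G => //; exists B].
- by move=> H [/Egood//|->].
- move=> H K [EH|->] [EK|->] //.
  + exact: Etriv.
  + by move=> [U [HU /GnE]]; case; exists H.
  + by move=> [U [/GnE + KU]]; case; exists K.
Qed.

End Infinite.

(** * Factorizations *)

Section Factorization.
Context {X : Type}.
Hypothesis X_infinite : infinite_set [set: X].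
Implicit Types (a b g : partmon X) (U : set (X + X)).

(** Colours are elements of [Q]. [k] indexes nontransversal blocks of [a]: one per lower vertex, one
    per connecting point of each colour, and a reserve in each colour. [i] indexes the groups: main,
    hub and third group of each colour. *)
Lemma index_injections (Q := (X + X)%type) :
  (exists k : X + (Q * X + Q * X) -> X, injective k) /\
  (exists i : Q + (Q + Q) -> X, injective i).
Proof.
have [s si] := infinite_sum_inj X_infinite.
have [p pi] := infinite_prod_inj X_infinite.
split.
  exists (fun t => match t with
    | inl x => s (inl x)
    | inr (inl (c, x)) => s (inr (s (inl (p (s c, x)))))
    | inr (inr (c, x)) => s (inr (s (inr (p (s c, x))))) end).
  move=> [x|[[c x]|[c x]]] [y|[[d y]|[d y]]] /si[] //.
  - by move=> ->.
  - by move=> /si[] /pi[] /si -> ->.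
  - by move=> /si[].
  - by move=> /si[].
  - by move=> /si[] /pi[] /si -> ->.
exists (fun t => match t with
  | inl c => s (inl (s c))
  | inr (inl c) => s (inr (s (inl (s c))))
  | inr (inr c) => s (inr (s (inr (s c)))) end).
move=> [c|[c|c]] [d|[d|d]] /si[] //.
- by move=> /si ->.
- by move=> /si[] /si ->.
- by move=> /si[].
- by move=> /si[].
- by move=> /si[] /si ->.
Qed.

Lemma card_ge2_other T (A : set T) : `I_2 #<= A -> forall x,
  exists2 y, A y & y <> x.
Proof.
move=> A2 x; have [f fA fi] := card_le_funP x A2.
have [f0|] := pselect (f 0 = x); last by exists (f 0) => //; exact: fA.
exists (f 1); first exact: fA.
by rewrite -f0 => /fi; move=> /(_ isT isT).
Qed.

(* Each block of [g] gets a colour [c].  The blocks of [b] in the main group of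
   colour [c] are tied together through one big block of the hub group of that
   colour, using one nontransversal block of [a] with two lower points each; every
   upper vertex of colour [c] is attached to a free point of the main group, and so
   is every lower vertex, through one more such block of [a]. All other points are
   matched arbitrarily within their colour, for which the third group provides
   room. *)
Lemma factorization a b g (d1 d2 : X -> X) (G : X -> set (set (X + X))) :
  in_L a -> in_R b ->
  (forall x y, ~ same_block a (inl x) (inr (d1 y))) ->
  (forall x y, same_block a (inr (d1 x)) (inr (d1 y)) -> x = y) ->
  (forall x, same_block a (inr (d1 x)) (inr (d2 x))) ->
  (forall x, d2 x <> d1 x) ->
  (forall x, G x `<=` [set U | blocks b U /\ lower U = set0]) ->
  (forall x y U, G x U -> G y U -> x = y) ->
  (forall x, [set: X] #<= \bigcup_(U in G x) upper U) ->
  (forall x, ~ ([set: X] #<= G x)) ->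
  (forall x y U, G x U -> G y #<= upper U) ->
  exists2 h, bijective h & g = (a * (perm h * b))%g.
Proof.
move=> La Rb d1N d1i d12 d2N GP Gi Gbig Gsmall Groom.
have [[k ki] [i ii]] := index_injections.
set Q := (X + X)%type in k ki i ii.
have [x0 _] := infinite_setN0 X_infinite.
have [m am mi] := in_L_points La; have [aT aI] := (in_LP a).1 La.
have [/choice[m' bm'] bI] := (in_RP b).1 Rb.
(* The colour of a block of [g] is a representative of it. *)
have [cls clsP] : exists cls : X + X -> Q,
    forall u v, same_block g u v <-> cls u = cls v.
  have /choice[r rP] U : exists u, U !=set0 -> U u.
    by have [[u Uu]|?] := pselect (U !=set0); [exists u|exists (inl x0)].
  exists (fun u => r (block_of g u)) => u v; rewrite -block_of_eq.
  split=> [->//|E]; have gr w : same_block g w (r (block_of g w)).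
    by apply: rP; exists w; exact: block_of_refl.
  by apply/block_of_eq; apply: same_block_trans (gr u) _; rewrite E; exact: same_block_sym.
pose kcls (t : X + (Q * X + Q * X)) : Q :=
  match t with inl z => cls (inr z) | inr (inl (c, _)) | inr (inr (c, _)) => c end.
pose icls (t : Q + (Q + Q)) : Q :=
  match t with inl c | inr (inl c) | inr (inr c) => c end.
(* The blocks of [a] are coloured as their role demands; those without a role get the arbitrary
   colour [inl x0]. The same is done for [b] with [qr]. *)
have [ql [qlx qlk]] : exists ql : set (X + X) -> Q,
    (forall x, ql (block_of a (inl x)) = cls (inl x)) /\
    forall t, ql (block_of a (inr (d1 (k t)))) = kcls t.
  have /choice[ql qlP] U : exists c, (forall x, U = block_of a (inl x) -> c = cls (inl x)) /\
      (forall t, U = block_of a (inr (d1 (k t))) -> c = kcls t).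
    have [[x ->]|nx] := pselect (exists x, U = block_of a (inl x)).
      exists (cls (inl x)); split=> [y /block_of_eq/aI -> //|t].
      by move=> E; case: (d1N x (k t)); apply/block_of_eq.
    have [[t Ut]|nt] := pselect (exists t, U = block_of a (inr (d1 (k t)))).
      exists (kcls t); split=> [x E|s]; first by case: nx; exists x.
      by rewrite Ut => /block_of_eq/d1i/ki ->.
    by exists (inl x0); split=> [x E|t E]; [case: nx; exists x|case: nt; exists t].
  by exists ql; split=> [x|t]; [apply: (qlP _).1|apply: (qlP _).2].
have [qr [qrz qri]] : exists qr : set (X + X) -> Q,
    (forall z, qr (block_of b (inr z)) = cls (inr z)) /\
    forall t U, G (i t) U -> qr U = icls t.
  have /choice[qr qrP] U : exists c, (forall z, U = block_of b (inr z) -> c = cls (inr z)) /\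
      (forall t, G (i t) U -> c = icls t).
    have [[z ->]|nz] := pselect (exists z, U = block_of b (inr z)).
      exists (cls (inr z)); split=> [y /block_of_eq/bI -> //|t /GP[_ U0]].
      have : lower (block_of b (inr z)) z by exact: block_of_refl.
      by rewrite U0.
    have [[t Gt]|nt] := pselect (exists t, G (i t) U).
      exists (icls t); split=> [z E|s /Gi/(_ Gt)/ii -> //].
      by case: nz; exists z.
    by exists (inl x0); split=> [z E|t E]; [case: nz; exists z|case: nt; exists t].
  exists qr; split=> [z|t U]; first by have [+ _] := qrP (block_of b (inr z)); apply.
  by have [_] := qrP U; apply.
pose q x := ql (block_of a (inr x)); pose q' x := qr (block_of b (inl x)).
have /choice[p pP] U : exists x, upper U !=set0 -> U (inl x).
  by have [[x Ux]|?] := pselect (upper U !=set0); [exists x|exists x0].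
have Gup t U : G t U -> upper U !=set0.
  move=> /GP[bU L0]; have [[x|z] Uz] := block_nonempty bU; first by exists x.
  by have : lower U z by []; rewrite L0.
have Gpt t U : G t U -> U = block_of b (inl (p U)).
  by move=> GU; apply: block_ofE (pP _ (Gup _ _ GU)); have [] := GP _ _ GU.
have Gne t : exists U, G t U.
  have /card_leTP[f fG _] := Gbig t.
  by have [U GU _] := fG x0; exists U.
(* One connecting point in each block of the main group of colour [c]. *)
pose conn c := p @` G (i (inl c)).
have connG c w : conn c w -> G (i (inl c)) (block_of b (inl w)).
  by move=> [U GU <-]; rewrite -(Gpt _ _ GU).
have /choice[hub hubG] c := Gne (i (inr (inl c))).
have /choice[e eP] c : exists e : X -> X,
    (forall w, conn c w -> upper (hub c) (e w)) /\
    (forall w w', conn c w -> conn c w' -> e w = e w' -> w = w').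
  have H : conn c #<= upper (hub c).
    apply: card_le_trans (card_image_le _ _) _; exact: Groom (hubG c).
  by have [e ? ?] := card_le_funP x0 H; exists e.
have eG c w : conn c w -> G (i (inr (inl c))) (block_of b (inl (e c w))).
  move=> cw; have [/(_ w cw) H _] := eP c; have [bU _] := GP _ _ (hubG c).
  by rewrite -(block_ofE bU H).
have upG t x : (\bigcup_(U in G t) upper U) x -> G t (block_of b (inl x)).
  by move=> [U GU Ux]; have [bU _] := GP _ _ GU; rewrite -(block_ofE bU Ux).
(* The main group covers |X| points but has fewer than |X| connecting points, so |X| points remain,
   enough for one per vertex. *)
have /choice[free freeP] c : exists f : X + X -> X, [/\ injective f,
    forall u, G (i (inl c)) (block_of b (inl (f u))) & forall u, ~ conn c (f u)].
  set W := \bigcup_(U in G (i (inl c))) upper U.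
  have [H|H] : [set: X] #<= W `\` conn c \/ [set: X] #<= conn c; first last.
  - by case: (Gsmall (i (inl c))); apply: card_le_trans H (card_image_le _ _).
  - have [s si] := infinite_sum_inj X_infinite.
    have /card_leTP[f fW fi] := H.
    exists (f \o s); split=> [u v /fi/si //|u|u] /=; have [Wu nu] := fW (s u) => //.
    exact: upG.
  apply: infinite_le_setU => //; apply: card_le_trans (Gbig (i (inl c))) _.
  apply: subset_card_le => x Wx.
  by have [?|?] := pselect (conn c x); [right|left].
have /choice[jr jrP] c : exists f : X -> X, injective f /\
    forall x, G (i (inr (inr c))) (block_of b (inl (f x))).
  have /card_leTP[f fW fi] := Gbig (i (inr (inr c))).
  by exists f; split=> // x; exact: upG.
pose dd n (s : bool) := if s then d1 n else d2 n.
have add n s : same_block a (inr (d1 n)) (inr (dd n s)).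
  by case: s; [exact: same_block_refl|exact: d12].
have ddi n s n' s' : dd n s = dd n' s' -> n = n' /\ s = s'.
  move=> E; have nn : n = n'.
    apply: d1i; apply: same_block_trans (add n s) _.
    by rewrite E; exact: same_block_sym.
  split=> //; move: E; rewrite -nn.
  by case: s s' => -[] //= E; [case: (d2N n)|case: (d2N n)].
have mdd x n s : m x <> dd n s.
  move=> E; apply: (d1N x n); apply: same_block_trans (am x) _.
  by rewrite E; exact: same_block_sym (add n s).
(* Indices of the prescribed values of [h]: [inl x] for the transversal block of x in [a], and
   [inr (t, s)] for the two chosen points of the nontransversal block indexed by [t]. *)
pose T := (X + (X + Q * X) * bool)%type.
pose emb (t : X + Q * X) : X + (Q * X + Q * X) :=
  match t with inl z => inl z | inr cw => inr (inl cw) end.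
have embi : injective emb by move=> [z|z] [w|w] // [->].
pose dom (t : T) := if t is inr (inr (c, w), _) then conn c w else True.
pose pl (t : T) := match t with inl x => m x | inr (t, s) => dd (k (emb t)) s end.
pose pr (t : T) := match t with
  | inl x => free (cls (inl x)) (inl x)
  | inr (inl z, true) => m' z
  | inr (inl z, false) => free (cls (inr z)) (inr z)
  | inr (inr (c, w), true) => w
  | inr (inr (c, w), false) => e c w end.
(* The type of block of [b] that receives the point, [None] standing for transversal. A block has
   only one type, which settles colours and most cases of injectivity. *)
pose kind (t : T) : option (Q + (Q + Q)) := match t with
  | inl x => Some (inl (cls (inl x)))
  | inr (inl z, true) => None
  | inr (inl z, false) => Some (inl (cls (inr z)))
  | inr (inr (c, w), true) => Some (inl c)
  | inr (inr (c, w), false) => Some (inr (inl c)) end.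
pose K (U : set (X + X)) (o : option (Q + (Q + Q))) :=
  if o is Some t then G (i t) U else exists z, U (inr z).
have Ki U o o' : K U o -> K U o' -> o = o'.
  case: o o' => [t|] [t'|] //=.
  - by move=> /Gi Gt /Gt/ii ->.
  - by move=> /GP[_ U0] [z Uz]; have : lower U z by []; rewrite U0.
  - by move=> [z Uz] /GP[_ U0]; have : lower U z by []; rewrite U0.
have prK t : dom t -> K (block_of b (inl (pr t))) (kind t).
  case: t => [x|[[z|[c w]] [|]]] /= dt.
  - by have [_ + _] := freeP (cls (inl x)); apply.
  - by exists z; exact: same_block_sym.
  - by have [_ + _] := freeP (cls (inr z)); apply.
  - exact: connG.
  - exact: eG.
have pli s t : dom s -> dom t -> pl s = pl t -> s = t.
  case: s t => [x|[s r]] [y|[t r']] /= _ _.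
  - by move=> /mi ->.
  - by move=> /mdd.
  - by move=> /esym/mdd.
  - by move=> /ddi[/ki/embi -> ->].
have pri s t : dom s -> dom t -> pr s = pr t -> s = t.
  move=> ds dt E.
  have kst : kind s = kind t.
    by apply: Ki (prK s ds) _; rewrite E; exact: prK.
  have freei c u v : free c u = free c v -> u = v.
    by have [+ _ _] := freeP c; apply.
  have freeN c u w : conn c w -> free c u <> w.
    by move=> cw fw; have [_ _ /(_ u)] := freeP c; rewrite fw.
  move: ds dt E kst.
  case: s t => [x|[[z|[c w]] [|]]] [x'|[[z'|[c' w']] [|]]] //= ds dt E.
  - by move=> [cc]; move: E; rewrite cc => /freei[->].
  - by move=> [cc]; move: E; rewrite cc => /freei.
  - by move=> [cc]; move: E; rewrite cc => /(freeN _ _ _ dt).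
  - move=> _; congr (inr (inl _, _)); apply: bI.
    by apply: same_block_trans (bm' z) _; rewrite E; exact: same_block_sym.
  - by move=> [cc]; move: E; rewrite cc => /freei.
  - by move=> [cc]; move: E; rewrite cc => /freei[->].
  - by move=> [cc]; move: E; rewrite cc => /(freeN _ _ _ dt).
  - by move=> [cc]; move: E; rewrite -cc => /esym/(freeN _ _ _ ds).
  - by move=> [cc]; move: E; rewrite -cc => /esym/(freeN _ _ _ ds).
  - by move=> [cc]; rewrite cc E.
  - move=> [cc]; move: dt E; rewrite -cc => dt E.
    by have [_ /(_ _ _ ds dt E) ->] := eP c.
(* Points of the reserve blocks, which the prescribed matching never touches. *)
pose jl c x := d1 (k (inr (inr (c, x)))).
have jld c x : jl c x = dd (k (inr (inr (c, x)))) true by [].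
have [h [hb hq hpl]] : exists h, [/\ bijective h, forall x, q' (h x) = q x &
    forall t, dom t -> h (pl t) = pr t].
  apply: (@matching_extension X Q T q q' dom pl pr jl jr pli pri).
  - move=> t dt; have := prK t dt; rewrite /q /q'.
    have qm x : ql (block_of a (inr (m x))) = cls (inl x).
      by rewrite -qlx; congr ql; apply/block_of_eq/same_block_sym.
    have qd n s : ql (block_of a (inr (dd (k n) s))) = kcls n.
      by rewrite -qlk; congr ql; apply/block_of_eq/same_block_sym/add.
    have -> : ql (block_of a (inr (pl t))) = match t with
      inl x => cls (inl x) | inr (s, _) => kcls (emb s) end.
      by case: (t) => [x|[s r]]; [exact: qm|exact: qd].
    case: t dt => [x|[[z|[c w]] [|]]] dt.
    + by move=> /qri ->.
    + move=> _; rewrite -[LHS]/(cls (inr z)) -qrz; congr qr.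
      exact/block_of_eq.
    + by move=> /qri ->.
    + by move=> /qri ->.
    + by move=> /qri ->.
  - by move=> c x y; rewrite !jld => /ddi[/ki[]].
  - by move=> c; case: (jrP c).
  - by move=> c x; rewrite /q /jl qlk.
  - by move=> c x; rewrite /q'; have [_ /(_ x)/qri ->] := jrP c.
  - move=> c x [y|[t s]] _ /=; rewrite jld; first by move=> /esym/mdd.
    by move=> /ddi[/ki]; case: t.
  - move=> c x t dt E; have [_ /(_ x)] := jrP c; rewrite E => H.
    by have := Ki _ (Some _) _ H (prK t dt); case: (t) => [?|[[?|[? ?]] [|]]].
exists h => //; set b' := (perm h * b)%g; have [h' hK h'K] := hb.
(* A colour constant along the edges of the product graph, so the product joins nothing that [g]
   separates. *)
pose key (v : vertex) : Q := match v with
  | Up x => cls (inl x) | Mid x => q x | Low z => cls (inr z) end.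
have keyo u : key (outer u) = cls u by case: u.
(* The middle vertex sent by [h] into the hub block of colour [c]; all outer vertices of that colour
   will be joined to it. *)
pose hm c := h' (p (hub c)).
have mid x y : same_block b (inl (h x)) (inl (h y)) ->
    joined a b' (Mid x) (Mid y).
  move=> xy; apply: (@joined_up _ a b' (inl x) (inl y)).
  exact/same_block_permM.
have dmid n : joined a b' (Mid (d1 n)) (Mid (d2 n)).
  exact: (@joined_low _ a b' (inr _) (inr _)).
(* The path goes from the free point to the connecting point of its block, then through a block of
   [a] to the hub. *)
have freej c u x : h x = free c u -> joined a b' (Mid x) (Mid (hm c)).
  move=> hx; have [_ /(_ u) GU _] := freeP c; set U := block_of _ _ in GU.
  have cw : conn c (p U) by exists U.
  pose t s : T := inr (inr (c, p U), s).
  pose n := k (inr (inl (c, p U))).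
  have h1 : h (d1 n) = p U by exact: (hpl (t true)).
  have h2 : h (d2 n) = e c (p U) by exact: (hpl (t false)).
  apply: rt_trans (mid x (d1 n) _) _.
    by rewrite h1 hx; exact: (pP U (Gup _ _ GU)).
  apply: rt_trans (dmid n) (mid _ _ _).
  rewrite h2 /hm h'K; apply/block_of_eq; rewrite -(Gpt _ _ (hubG c)).
  have [/(_ _ cw) Ue _] := eP c; have [bU _] := GP _ _ (hubG c).
  by rewrite -(block_ofE bU Ue).
have outj u : joined a b' (outer u) (Mid (hm (cls u))).
  case: u => [x|z].
    apply: rt_trans (joined_low b' (am x)) _.
    by apply: (freej _ (inl x)); exact: (hpl (inl x)).
  have h1 : h (d1 (k (inl z))) = m' z by exact: (hpl (inr (inl z, true))).
  apply: rt_trans (_ : joined a b' _ (Mid (d1 (k (inl z))))) _.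
    apply: (@joined_up _ a b' (inr z) (inl _)); apply/same_block_permM.
    by rewrite /= h1.
  apply: rt_trans (dmid _) _; apply: (freej _ (inr z)).
  exact: (hpl (inr (inl z, false))).
apply: partmon_eq => u v; rewrite same_block_mul clsP; split=> [uv|].
  apply: rt_trans (outj u) _; rewrite uv; exact: joined_sym (outj v).
rewrite -!keyo; apply: joined_key.
  have kl w : key (relabel_low w) = ql (block_of a w) by case: w.
  by move=> w z /block_of_eq wz; rewrite !kl wz.
have ku w : key (relabel_up w) = qr (block_of b (on_upper h w)).
  by case: w => [x|z] /=; rewrite -?hq ?qrz.
by move=> w z /same_block_permM/block_of_eq wz; rewrite !ku wz.
Qed.

End Factorization.

(** * Small cardinals, and block counts under reflection *)

Lemma card_ge1 T (A : set T) : `I_1 #<= A <-> A !=set0.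
Proof.
split=> [A1|[x Ax]].
  apply/set0P/negP => /eqP A0; move: A1; rewrite A0 => /card_le0P I0.
  by have : set0 0 by rewrite -I0.
by apply: (@card_le_fun _ _ _ _ (fun=> x)) => // -[|m] [|n].
Qed.

Lemma card_ge2 T (A : set T) x y : A x -> A y -> x <> y -> `I_2 #<= A.
Proof.
move=> Ax Ay xy.
apply: (@card_le_fun _ _ _ _ (fun n => if n is 0 then x else y)).
  by move=> [|n].
by move=> [|[|//]] [|[|//]] //= _ _ E; case: xy.
Qed.

Lemma finite_le_infinite T U (A : set T) (B : set U) :
  finite_set A -> infinite_set B -> A #<= B.
Proof.
move=> fA iB; have [//|BA] := card_le_total A B.
by case: iB; exact: card_le_finite BA fA.
Qed.

Section FlipCounts.
Context {X : Type}.
Implicit Types (a b : partmon X) (U V : set (X + X)) (S : set (set (X + X))).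

Lemma blocks_flip a U : blocks a U -> blocks (flip a) (swap @^-1` U).
Proof.
move=> /blocksE[u ->]; apply/blocksE; exists (swap u).
by apply/seteqP; split=> v; rewrite /= same_block_flip swapK.
Qed.

Lemma card_le_flip S S' : (forall U, S U -> S' (swap @^-1` U)) -> S #<= S'.
Proof.
move=> SS; apply: card_le_fun SS _ => U V _ _ E.
apply/seteqP; split=> u; rewrite -(swapK u).
  by move=> Uu; have : (swap @^-1` U) (swap u) by []; rewrite E.
by move=> Uu; have : (swap @^-1` V) (swap u) by []; rewrite -E.
Qed.

Lemma k_up_flip a M (mu : set M) : k_up a mu #<= k_low (flip a) mu.
Proof. by apply: card_le_flip => U [/blocks_flip ? [? ?] ?]. Qed.

Lemma d_up_flip a M (mu : set M) : d_up a mu #<= d_low (flip a) mu.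
Proof. by apply: card_le_flip => U [/blocks_flip ? ? ?]. Qed.

Lemma k_low_flip a M (mu : set M) : k_low (flip a) mu #<= k_up a mu.
Proof.
by apply: card_le_flip => U [/blocks_flip]; rewrite flipK => ? [? ?] ?.
Qed.

Lemma d_low_flip a M (mu : set M) : d_low (flip a) mu #<= d_up a mu.
Proof. by apply: card_le_flip => U [/blocks_flip]; rewrite flipK. Qed.

Lemma d_low1 a :
  d_low a `I_1 = [set U | [/\ blocks a U, upper U = set0 & lower U !=set0]].
Proof. by apply/seteqP; split=> U [? ? /card_ge1]. Qed.

End FlipCounts.

(** * Sufficiency of the first case *)

Section Sufficiency.
Context {X : Type}.
Hypotheses (X_infinite : infinite_set [set: X]) (X_singular : singular [set: X]).
Implicit Types (a b g : partmon X).

Lemma sufficient a b g : in_L a -> in_R b ->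
  [set: X] #<= d_low a `I_1 -> [set: X] #<= d_up b `I_1 ->
  [set: X] #<= set_sum (k_low a `I_2) (d_low a `I_2) ->
  (forall mu : set X, mu #< [set: X] ->
    [set: X] #<= set_sum (k_up b mu) (d_up b mu)) ->
  generated a b g.
Proof.
move=> La Rb da db ka kb.
(* For [a] one condition is enough: two lower points in a block. *)
have [||||a1 [ga La1 /(_ tt) a1P]] :=
    @chain_low_blocks X X_infinite unit (fun _ A => `I_2 #<= A) a La.
- by rewrite -d_low1.
- by move=> i A B /subset_card_le AB h; exact: card_le_trans h AB.
- by move=> i j; left.
- by move=> i; exact: infinite_le_set_sum ka.
have Lb : in_L (flip b) by rewrite in_L_flip.
(* For [b] all cardinals below |X| are treated together as one chain of conditions on the reflected
   element. *)
pose I := {mu : set X | mu #< [set: X]}.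
have [||||b1 [gb Lb1 b1P]] :=
    @chain_low_blocks X X_infinite I (fun mu A => sval mu #<= A) (flip b) Lb.
- by rewrite -d_low1; exact: card_le_trans db (d_up_flip _ _).
- by move=> i A B /subset_card_le AB h; exact: card_le_trans h AB.
- move=> mu nu; have [mn|nm] := card_le_total (sval mu) (sval nu).
    by right=> A; exact: card_le_trans mn.
  by left=> A; exact: card_le_trans nm.
- move=> [mu muX] /=; have [h|h] := infinite_le_set_sum X_infinite (kb _ muX).
    by left; exact: card_le_trans h (k_up_flip _ _).
  by right; exact: card_le_trans h (d_up_flip _ _).
have [|G [GC Gi Gbig Gsmall Groom]] := @disjoint_groups X X_infinite
  [set U | blocks (flip b1) U /\ lower U = set0] X_singular.
  move=> mu muX; apply: card_le_trans (b1P (exist _ mu muX)) _.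
  by apply: card_le_flip => U [/blocks_flip ? ? ?].
have ge2 A : `I_2 #<= A -> A !=set0.
  by move=> A2; apply/card_ge1; apply: card_le_trans A2; rewrite card_le_II.
have [d1 [d1N d1i d1P]] := @low_points X a1 (fun A => `I_2 #<= A) (@ge2 X) a1P.
have /choice[d2 d2P] x : exists y, same_block a1 (inr (d1 x)) (inr y) /\ y <> d1 x.
  by have [y] := card_ge2_other (d1P x) (d1 x); exists y.
have [|||h hb ->] := @factorization X X_infinite a1 (flip b1) g d1 d2 G La1 _ d1N d1i
    _ _ GC Gi Gbig Gsmall Groom.
- by rewrite in_R_flip.
- by move=> x; have [] := d2P x.
- by move=> x; have [] := d2P x.
- apply: generated_mul; first exact: ga.
  apply: generated_mul; first by apply: generated_sym_grp; exact: sym_grp_perm.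
  by have := generated_flip (gb (flip a)); rewrite !flipK generatedC.
Qed.
End Sufficiency.

(** * Necessity *)

Section Inheritance.
Context {X : Type}.
Hypothesis X_infinite : infinite_set [set: X].
Implicit Types (a b g : partmon X) (U V : set (X + X)).

Lemma sym_grp_mul a b : sym_grp a -> sym_grp b -> sym_grp (a * b)%g.
Proof.
move=> [a' [aa a'a]] [b' [bb b'b]]; exists (b' * a')%g; split.
  by rewrite -mulgA (mulgA b) bb mul1g.
by rewrite -mulgA (mulgA a') a'a mul1g.
Qed.

(** The blocks are {x, e(inl x)'} and singletons below; the points e(inr x)' supply |X| of the
    latter. *)
Lemma exists_L_many_low : exists g, [/\ in_L g, ~ sym_grp g &
  [set: X] #<= [set U | blocks g U /\ upper U = set0]].
Proof.
have [x0 _] := infinite_setN0 X_infinite.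
have [e ei] := infinite_sum_inj X_infinite.
pose g := kernel (fun u => match u with inl x => e (inl x) | inr y => y end).
have gE := same_block_kernel (fun u => match u with inl x => e (inl x) | inr y => y end).
have low x U : blocks g U -> U (inr (e (inr x))) -> upper U = set0.
  move=> gU Ux; rewrite -subset0 => y Uy.
  have /gE/ei : same_block g (inl y) (inr (e (inr x))) by exists U.
  by [].
exists g; split.
- apply/in_LP; split=> [x|x y /gE/ei[]//].
  by exists (e (inl x)); apply/gE.
- move=> /sym_grpP h; have [x [y E]] := h _ (blocks_of g (inr (e (inr x0)))).
  have := low x0 _ (blocks_of g _) (block_of_refl g _).
  rewrite E => /seteqP[+ _] => /(_ x); apply.
  by left.
- apply: (@card_le_fun _ _ _ _ (fun x => block_of g (inr (e (inr x))))).
    by move=> x _; split; [exact: blocks_of|exact: low (blocks_of _ _) (block_of_refl _ _)].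
  by move=> x y _ _ /block_of_eq/gE/ei[].
Qed.

Lemma exists_many_big_low :
  exists g, [set: X] #<= [set U | blocks g U /\ [set: X] #<= lower U].
Proof.
have [x0 _] := infinite_setN0 X_infinite.
have [e ei] := infinite_prod_inj X_infinite.
(* [f] decodes the first coordinate, so the lower part of the block of x contains the row of all
   e(x, y). *)
have /choice[f fP] y : exists x, forall p, y = e p -> x = p.1.
  have [[p ->]|np] := pselect (exists p, y = e p).
    by exists p.1 => q /ei ->.
  by exists x0 => p yp; case: np; exists p.
pose key (u : X + X) := match u with inl x => x | inr y => f y end.
exists (kernel key); apply: (@card_le_fun _ _ _ _ (fun x => block_of (kernel key) (inl x))).
  move=> x _; split; first exact: blocks_of.
  apply: (@card_le_fun _ _ _ _ (fun y => e (x, y))) => [y _|y z _ _ /ei[]//].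
  by apply/same_block_kernel; rewrite /= (fP _ _ erefl).
by move=> x y _ _ /block_of_eq/same_block_kernel.
Qed.

(** Otherwise every generated element of L_X is a unit: the left factor of a product in L_X is in
    L_X, hence a unit, and cancelling it leaves the right factor in L_X. *)
Lemma generator_in_L alpha beta : (forall g, generated alpha beta g) ->
  exists a, [/\ a = alpha \/ a = beta, in_L a & ~ sym_grp a].
Proof.
move=> gen; apply: contrapT => na.
have [g [Lg nSg _]] := exists_L_many_low; apply: nSg.
move: Lg; pose H := [set g : partmon X | in_L g -> sym_grp g].
apply: (@generated_ind _ alpha beta H _ _ _ _ g (gen g)) => //.
- move=> a b Ha Hb Lab; have Sa := Ha (in_L_factor Lab).
  apply: sym_grp_mul => //; apply: Hb; have [c [ac ca]] := Sa.
  have -> : b = (c * (a * b))%g by rewrite mulgA ca mul1g.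
  by apply: in_L_mul Lab; apply: sym_grp_in_L; exists a.
- by move=> a Sa _.
- move=> La; apply: contrapT => nS; apply: na; exists alpha.
  by split; [left|exact: La|exact: nS].
- move=> La; apply: contrapT => nS; apply: na; exists beta.
  by split; [right|exact: La|exact: nS].
Qed.

(** A block of the product with the property has, within its component, a block of a factor with the
    property. Components being disjoint, this bounds the count in a product by the sum of the counts
    in its factors. *)
Definition inherited (P : set (X + X) -> Prop) := forall a b U,
  blocks (a * b)%g U -> P U -> exists V u v, [/\ V u, U v, P V &
    blocks a V /\ joined a b (relabel_low u) (outer v) \/
    blocks b V /\ joined a b (relabel_up u) (outer v)].

Lemma few_generated (P : set (X + X) -> Prop) alpha beta g : inherited P ->
  (forall a U, sym_grp a -> blocks a U -> ~ P U) ->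
  ~ ([set: X] #<= [set U | blocks alpha U /\ P U]) ->
  ~ ([set: X] #<= [set U | blocks beta U /\ P U]) ->
  generated alpha beta g -> ~ ([set: X] #<= [set U | blocks g U /\ P U]).
Proof.
move=> inh SP fa fb; move: g.
apply: (@generated_ind _ alpha beta
  [set g | ~ ([set: X] #<= [set U | blocks g U /\ P U])]) => //=; last first.
  move=> a Sa /=; have -> : [set U | blocks a U /\ P U] = set0.
    by rewrite -subset0 => U [aU PU]; exact: (SP a U Sa aU PU).
  move=> /card_le0P E; have [x _] := infinite_setN0 X_infinite.
  by have : set0 x by rewrite -E.
move=> a b na nb; set S := [set U | blocks (a * b)%g U /\ P U] => XS.
suff SAB : S #<= set_sum [set U | blocks a U /\ P U] [set U | blocks b U /\ P U].
  by case: (infinite_le_set_sum X_infinite (card_le_trans XS SAB)).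
apply: (@card_le_rel _ _ _ _ (fun U p => match p with
    | inl V => blocks a V /\ exists u v, [/\ V u, U v & joined a b (relabel_low u) (outer v)]
    | inr V => blocks b V /\ exists u v, [/\ V u, U v & joined a b (relabel_up u) (outer v)]
    end)).
  move=> U [abU PU]; have [V [u [v [Vu Uv PV [[aV j]|[bV j]]]]]] := inh _ _ _ abU PU.
    by exists (inl V) => //; split=> //; exists u, v.
  by exists (inr V) => //; split=> //; exists u, v.
move=> U U' [V|V] [abU _] [abU' _] _ [aV [u [v [Vu Uv j]]]] [_ [u' [v' [Vu' Uv' j']]]].
  rewrite (block_ofE abU Uv) (block_ofE abU' Uv'); apply/block_of_eq.
  apply/same_block_mul; apply: rt_trans (joined_sym j) (rt_trans _ _ _ _ _ _ j').
  by apply: joined_low; exists V.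
rewrite (block_ofE abU Uv) (block_ofE abU' Uv'); apply/block_of_eq.
apply/same_block_mul; apply: rt_trans (joined_sym j) (rt_trans _ _ _ _ _ _ j').
by apply: joined_up; exists V.
Qed.

(** Take a lower point z. Either its block in [b] misses the middle row and is itself the required
    block, or it meets a middle point m, and then the block of m in [a] cannot reach X. *)
Lemma inherited_low : inherited (fun U => upper U = set0).
Proof.
move=> a b U abU U0; have [[x|z] Uz] := block_nonempty abU.
  by have : upper U x by []; rewrite U0.
have [[m zm]|nm] := pselect (exists m, same_block b (inr z) (inl m)); last first.
  exists (block_of b (inr z)), (inr z), (inr z); split=> //.
  - exact: block_of_refl.
  - by rewrite -subset0 => m zm; apply: nm; exists m.
  - by right; split; [exact: blocks_of|exact: rt_refl].
exists (block_of a (inr m)), (inr m), (inr z).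
have mz : joined a b (Mid m) (Low z).
  exact: (joined_up a (same_block_sym zm)).
split=> //; first exact: block_of_refl.
  rewrite -subset0 => x mx; have : upper U x; last by rewrite U0.
  rewrite /upper /= (block_ofE abU Uz); apply/same_block_mul/joined_sym.
  by apply: rt_trans mz; exact: (joined_low b (same_block_sym mx)).
by left; split=> //; exact: blocks_of.
Qed.

(** If no block in the component of y' has two lower points, the component is the block of y' in [b]
    with the blocks of [a] above it. Each of these meets the middle row only once, so y' is the only
    lower vertex. *)
Lemma inherited_two : inherited (fun U => `I_2 #<= lower U).
Proof.
move=> a b U abU U2.
have [y Uy] : lower U !=set0.
  by apply/card_ge1; apply: card_le_trans U2; rewrite card_le_II.
have [z Uz zy] := card_ge2_other U2 y; apply: contrapT => nV.
have yz : joined a b (Low y) (Low z).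
  by apply/(same_block_mul a b (inr y) (inr z)); exists U.
have na m m' : joined a b (Low y) (Mid m) -> same_block a (inr m) (inr m') -> m = m'.
  move=> ym mm; apply: contrapT => nm; apply: nV.
  exists (block_of a (inr m)), (inr m), (inr y); split=> //.
  - exact: block_of_refl.
  - by apply: (@card_ge2 _ _ m m') => //; exact: block_of_refl.
  - by left; split; [exact: blocks_of|exact: joined_sym].
have nb w : same_block b (inr y) (inr w) -> y = w.
  move=> yw; apply: contrapT => nm; apply: nV.
  exists (block_of b (inr y)), (inr y), (inr y); split=> //.
  - exact: block_of_refl.
  - by apply: (@card_ge2 _ _ y w) => //; exact: block_of_refl.
  - by right; split; [exact: blocks_of|exact: rt_refl].
pose P (p : @vertex X) := joined a b (Low y) p /\ match p with
  | Up x => exists2 m, same_block b (inr y) (inl m) & same_block a (inl x) (inr m)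
  | Mid m => same_block b (inr y) (inl m)
  | Low w => same_block b (inr y) (inr w) end.
have ymid m : same_block b (inr y) (inl m) -> joined a b (Low y) (Mid m).
  by move=> /(joined_up a).
suff [_ /nb yz'] : P (Low z) by apply: zy.
apply: (@joined_closed _ _ _ P) yz _; last by split; [exact: rt_refl|exact: same_block_refl].
  move=> u v uv [ju Pu]; split; first exact: rt_trans ju (joined_low b uv).
  case: u v uv ju Pu => [u|u] [v|v] uv ju /=.
  - by move=> [m ym um]; exists m => //; exact: same_block_trans (same_block_sym uv) um.
  - move=> [m ym um]; have <- // : m = v.
    by apply: na (ymid _ ym) _; exact: same_block_trans (same_block_sym um) uv.
  - by move=> yu; exists u => //; exact: same_block_sym.
  - by move=> yu; rewrite -(na _ _ ju uv).
move=> u v uv [ju Pu]; split; first exact: rt_trans ju (joined_up a uv).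
by case: u v uv ju Pu => [u|u] [v|v] uv ju /= yu; exact: same_block_trans yu uv.
Qed.

Lemma relabel_low_inj : injective (@relabel_low X).
Proof. by move=> [x|x] [y|y] // [->]. Qed.

Lemma relabel_up_inj : injective (@relabel_up X).
Proof. by move=> [x|x] [y|y] // [->]. Qed.

(* A component of the product graph is a countable union of balls, so it has at
   most |kappa| vertices if all the blocks in it have at most |kappa| elements. *)
Lemma inherited_big (kappa : set X) : infinite_set kappa ->
  inherited (fun U => ~ (U #<= kappa)).
Proof.
move=> ik a b U abU nU; apply: contrapT => nV; apply: nU.
have [v0 Uv0] := block_nonempty abU.
(* Neighbours through a block of [a] or of [b]; a middle vertex can have both kinds. *)
pose nb p : set (@vertex X) :=
  [set r | exists u v, [/\ p = relabel_low u, r = relabel_low v & same_block a u v]]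
  `|` [set r | exists u v, [/\ p = relabel_up u, r = relabel_up v & same_block b u v]].
have nbk p : joined a b (outer v0) p -> nb p #<= kappa.
  move=> jp; apply: infinite_setU_le => //.
    have [[u pu]|nu] := pselect (exists u, p = relabel_low u); last first.
      apply: finite_le_infinite => //; rewrite (_ : mkset _ = set0) //.
      by rewrite -subset0 => r [u [v [pu _ _]]]; apply: nu; exists u.
    apply: (@card_le_trans _ _ _ (block_of a u)).
      apply: card_le_trans (card_image_le (@relabel_low X) _).
      apply: subset_card_le => r [u' [v [pu' -> uv]]]; exists v => //.
      by rewrite (relabel_low_inj (etrans (esym pu) pu')).
    apply: contrapT => nk; apply: nV; exists (block_of a u), u, v0; split=> //.
      exact: block_of_refl.
    left; split; first exact: blocks_of.
    by rewrite -pu; exact: joined_sym.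
  have [[u pu]|nu] := pselect (exists u, p = relabel_up u); last first.
    apply: finite_le_infinite => //; rewrite (_ : mkset _ = set0) //.
    by rewrite -subset0 => r [u [v [pu _ _]]]; apply: nu; exists u.
  apply: (@card_le_trans _ _ _ (block_of b u)).
    apply: card_le_trans (card_image_le (@relabel_up X) _).
    apply: subset_card_le => r [u' [v [pu' -> uv]]]; exists v => //.
    by rewrite (relabel_up_inj (etrans (esym pu) pu')).
  apply: contrapT => nk; apply: nV; exists (block_of b u), u, v0; split=> //.
    exact: block_of_refl.
  right; split; first exact: blocks_of.
  by rewrite -pu; exact: joined_sym.
pose ball := fix ball n := if n is n.+1 then \bigcup_(p in ball n) nb p
  else [set outer v0].
have ballj n : ball n `<=` [set p | joined a b (outer v0) p].
  elim: n => [_ ->|n IHn r [p /IHn jp]]; first exact: rt_refl.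
  by move=> [] [u [v [pu -> uv]]]; apply: rt_trans jp _; rewrite pu;
    [exact: joined_low|exact: joined_up].
have ballk n : ball n #<= kappa.
  elim: n => [|n IHn]; first exact: finite_le_infinite (finite_set1 _) ik.
  by apply: bigcup_infinite_le => // p /ballj; exact: nbk.
apply: (@card_le_trans _ _ _ (\bigcup_n ball n)); last first.
  by apply: bigcup_infinite_le => //; exact/infiniteP.
apply: (@card_le_fun _ _ _ _ outer) => [v Uv|[x|x] [y|y] _ _ // [->] //].
have : joined a b (outer v0) (outer v) by apply/same_block_mul; exists U.
move=> /(@joined_closed _ _ _ (\bigcup_n ball n)); apply; last by exists 0.
  by move=> u w uw [n _ nu]; exists n.+1 => //; exists (relabel_low u) => //;
    left; exists u, w.
by move=> u w uw [n _ nu]; exists n.+1 => //; exists (relabel_up u) => //;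
  right; exists u, w.
Qed.

End Inheritance.

(** * The counting conditions forced on the generators *)

Section Necessity.
Context {X : Type}.
Hypotheses (X_infinite : infinite_set [set: X]) (X_singular : singular [set: X]).
Implicit Types (a b g : partmon X) (U V : set (X + X)).

(** If X were countable, all smaller sets would be finite, and a finite union of finite sets is
    finite. *)
Lemma singular_uncountable : ~ ([set: X] #<= [set: nat]).
Proof.
have [F [[FX XF] FB FU]] := X_singular => XN.
have fin T (A : set T) : ~ ([set: X] #<= A) -> finite_set A.
  by move=> XA; apply/finite_setPn => NA; apply: XA; exact: card_le_trans XN NA.
apply: X_infinite; rewrite -FU; apply: bigcup_finite; first exact: fin.
by move=> B /FB[_ /fin].
Qed.

Lemma infinite_majorant (mu nu : set X) : mu #< [set: X] -> nu #< [set: X] ->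
  exists kappa : set X, [/\ infinite_set kappa, ~ ([set: X] #<= kappa),
    mu #<= kappa & nu #<= kappa].
Proof.
have max (A B : set X) : ~ ([set: X] #<= A) -> ~ ([set: X] #<= B) ->
    exists C : set X, [/\ ~ ([set: X] #<= C), A #<= C & B #<= C].
  by move=> XA XB; have [AB|BA] := card_le_total A B; [exists B|exists A].
move=> [_ Xmu] [_ Xnu]; have [k [Xk muk nuk]] := max _ _ Xmu Xnu.
have /infiniteP/card_leTP[e _ ei] := X_infinite.
have Xe : ~ ([set: X] #<= range e).
  by move=> /card_le_trans/(_ (card_image_le _ _)); exact: singular_uncountable.
have [k' [Xk' kk' ek']] := max _ _ Xk Xe; exists k'; split=> //.
- apply/infiniteP; apply: card_le_trans ek'.
  by apply: (@card_le_fun _ _ _ _ e) => [n _|m n _ _ /ei//]; exists n.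
- exact: card_le_trans muk kk'.
- exact: card_le_trans nuk kk'.
Qed.

Lemma sym_grp_block a U : sym_grp a -> blocks a U ->
  exists x y, U = [set inl x; inr y].
Proof. by move=> /sym_grpP h; exact: h. Qed.

Lemma not_full_sub T (A B : set T) :
  A `<=` B -> ~ ([set: X] #<= B) -> ~ ([set: X] #<= A).
Proof. by move=> /subset_card_le AB nB XA; apply: nB; exact: card_le_trans XA AB. Qed.

Lemma not_full0 T : ~ ([set: X] #<= @set0 T).
Proof.
move=> /card_le0P E; have [x _] := infinite_setN0 X_infinite.
by have : set0 x by rewrite -E.
Qed.

Lemma in_R_lower b U : in_R b -> blocks b U -> upper U !=set0 /\ ~ (`I_2 #<= lower U).
Proof.
move=> /in_RP[bT bI] bU; split.
  have [[x|y] Uu] := block_nonempty bU; first by exists x.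
  by have [x yx] := bT y; exists x; rewrite /upper /= (block_ofE bU Uu).
move=> /[dup] U2 /card_le_trans.
have [y Uy] : lower U !=set0.
  by apply/card_ge1; apply: card_le_trans U2; rewrite card_le_II.
move=> _; have [z Uz zy] := card_ge2_other U2 y; apply: zy; apply: bI.
by exists U.
Qed.

(** Elements of R_X have no lower nontransversal blocks, so an element with |X| of them can only owe
    them to [a]. *)
Lemma necessary_low a b : (forall g, generated a b g) -> in_R b ->
  [set: X] #<= d_low a `I_1.
Proof.
move=> gen Rb; apply: contrapT => nd.
have [g [_ _ Xg]] := exists_L_many_low X_infinite.
apply: (few_generated X_infinite inherited_low _ _ _ (gen g)) Xg.
- move=> c U Sc cU; have [x [y ->]] := sym_grp_block Sc cU.
  by move=> /seteqP[+ _] => /(_ x); apply; left.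
- apply: not_full_sub nd => U [aU U0]; split=> //; apply/card_ge1.
  have [[x|y] Uu] := block_nonempty aU; last by exists y.
  by have : upper U x by []; rewrite U0.
- rewrite (_ : mkset _ = set0); first exact: not_full0.
  rewrite -subset0 => U [bU U0]; have [[x]] := in_R_lower Rb bU.
  by rewrite U0.
Qed.

Lemma big_low_sub a M (mu : set M) P : (forall U, P U -> lower U !=set0) ->
  (forall U, P U -> mu #<= lower U) ->
  [set U | blocks a U /\ P U] `<=` k_low a mu `|` d_low a mu.
Proof.
move=> P0 Pmu U [aU PU].
have [U0|/set0P Une] := eqVneq (upper U) set0; [right|left]; split=> //.
- exact: Pmu.
- by split=> //; exact: P0.
- exact: Pmu.
Qed.

Lemma necessary_two a b : (forall g, generated a b g) -> in_R b ->
  [set: X] #<= k_low a `I_2 `|` d_low a `I_2.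
Proof.
move=> gen Rb; apply: contrapT => nd.
have [g Xg] := exists_many_big_low X_infinite.
have : [set: X] #<= [set U | blocks g U /\ `I_2 #<= lower U].
  apply: card_le_trans Xg (subset_card_le _) => U [gU XU]; split=> //.
  by apply: card_le_trans XU; exact: finite_le_infinite (finite_II 2) X_infinite.
apply: (few_generated X_infinite inherited_two _ _ _ (gen g)).
- move=> c U Sc cU; exact: (in_R_lower (sym_grp_in_R Sc) cU).2.
- apply: not_full_sub nd; apply: big_low_sub => // U U2; apply/card_ge1.
  by apply: card_le_trans U2; rewrite card_le_II.
- rewrite (_ : mkset _ = set0); first exact: not_full0.
  by rewrite -subset0 => U [bU]; case: (in_R_lower Rb bU).
Qed.

Lemma in_L_big a (mu kappa : set X) : in_L a -> infinite_set kappa ->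
  mu #<= kappa ->
  [set U | blocks a U /\ ~ (U #<= kappa)] `<=` k_low a mu `|` d_low a mu.
Proof.
move=> La ik muk U [aU nU].
have [_ aI] := (in_LP a).1 La.
have nlow : ~ (lower U #<= kappa).
  move=> Uk; apply: nU; have -> : U = inl @` upper U `|` inr @` lower U.
    apply/seteqP; split=> [[x|y] Uu|u [] [x Ux <-]//]; first by left; exists x.
    by right; exists y.
  apply: infinite_setU_le => //; last exact: card_le_trans (card_image_le _ _) Uk.
  apply: finite_le_infinite => //; apply: finite_image.
  have [U0|/set0P[x Ux]] := eqVneq (upper U) set0; first by rewrite U0; exact: finite_set0.
  apply: (@sub_finite_set _ _ [set x]) (finite_set1 x) => y Uy.
  by apply: aI; exists U.
apply: (@big_low_sub a X mu (fun U => ~ (lower U #<= kappa))); last by split.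
- move=> V nV; apply/set0P/negP => /eqP V0; apply: nV; rewrite V0; exact: card_ge0.
- move=> V nV; have [//|kV] := card_le_total (lower V) kappa.
  exact: card_le_trans muk kV.
Qed.

Lemma flip_up_low b M (mu : set M) :
  [set: X] #<= k_low (flip b) mu `|` d_low (flip b) mu ->
  [set: X] #<= k_up b mu `|` d_up b mu.
Proof.
move=> /(infinite_le_setU X_infinite)[] h.
  apply: card_le_trans h (card_le_trans (k_low_flip _ _) _).
  by apply: subset_card_le; left.
apply: card_le_trans h (card_le_trans (d_low_flip _ _) _).
by apply: subset_card_le; right.
Qed.

(** If both alternatives failed, both generators would have fewer than |X| blocks larger than a
    common infinite [kappa] below |X|, and so would every product; some element has |X| blocks of
    size |X|. *)
Lemma necessary_big a b (mu nu : set X) : (forall g, generated a b g) ->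
  in_L a -> in_R b -> mu #< [set: X] -> nu #< [set: X] ->
  [set: X] #<= k_low a mu `|` d_low a mu \/ [set: X] #<= k_up b nu `|` d_up b nu.
Proof.
move=> gen La Rb muX nuX; apply: contrapT => /not_orP[nmu nnu].
have [kappa [ik Xk muk nuk]] := infinite_majorant muX nuX.
have [g Xg] := exists_many_big_low X_infinite.
have : [set: X] #<= [set U | blocks g U /\ ~ (U #<= kappa)].
  apply: card_le_trans Xg (subset_card_le _) => U [gU XU]; split=> //.
  move=> Uk; apply: Xk; apply: card_le_trans XU (card_le_trans _ Uk).
  by apply: (@card_le_fun _ _ _ _ inr) => // x y _ _ [].
apply: (few_generated X_infinite (inherited_big ik) _ _ _ (gen g)).
- move=> c U Sc cU; apply; have [x [y ->]] := sym_grp_block Sc cU.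
  exact: finite_le_infinite (finite_set2 _ _) ik.
- exact: not_full_sub (in_L_big La ik muk) nmu.
- move=> Xb; apply: nnu; apply: flip_up_low; apply: card_le_trans Xb _.
  have Lb : in_L (flip b) by rewrite in_L_flip.
  apply: card_le_trans (subset_card_le (in_L_big Lb ik nuk)).
  apply: card_le_flip => U [/blocks_flip bU nU]; split=> // Uk; apply: nU.
  apply: card_le_trans Uk; apply: (@card_le_fun _ _ _ _ swap) => [u|u v _ _].
    by rewrite /= swapK.
  exact: (inv_inj swapK).
Qed.

Lemma blocks_card a (S : set (set (X + X))) : S `<=` blocks a -> S #<= [set: X].
Proof.
move=> Sa; have [e ei] := infinite_sum_inj X_infinite.
apply: (@card_le_rel _ _ _ _ (fun U x => exists2 u, U u & e u = x)).
  by move=> U /Sa/block_nonempty[u Uu]; exists (e u) => //; exists u.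
move=> U V x /Sa aU /Sa aV _ [u Uu <-] [v Vv /ei uv]; rewrite uv in Vv.
exact: block_inj aU aV Uu Vv.
Qed.

Lemma set_sum_full a (S S' : set (set (X + X))) : S `<=` blocks a ->
  S' `<=` blocks a -> [set: X] #<= S `|` S' -> set_sum S S' #= [set: X].
Proof.
move=> Sa Sa' XS; rewrite card_eq_le; apply/andP; split.
  by apply: (infinite_set_sum_le X_infinite);
    [exact: blocks_card Sa|exact: blocks_card Sa'].
exact: card_le_trans XS (card_le_setU_sum _ _).
Qed.

Lemma k_low_sub a M (mu : set M) : k_low a mu `<=` blocks a.
Proof. by move=> U []. Qed.
Lemma d_low_sub a M (mu : set M) : d_low a mu `<=` blocks a.
Proof. by move=> U []. Qed.
Lemma k_up_sub a M (mu : set M) : k_up a mu `<=` blocks a.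
Proof. by move=> U []. Qed.
Lemma d_up_sub a M (mu : set M) : d_up a mu `<=` blocks a.
Proof. by move=> U []. Qed.

Lemma flip_full a b : (forall g, generated a b g) ->
  forall g, generated (flip b) (flip a) g.
Proof.
by move=> gen g; have := generated_flip (gen (flip g)); rewrite flipK generatedC.
Qed.

Lemma necessary a b : (forall g, generated a b g) -> in_L a -> in_R b ->
  (d_low a `I_1 #= [set: X] /\ d_up b `I_1 #= [set: X]) /\
  ((forall mu : set X, mu #< [set: X] ->
     set_sum (k_low a `I_2) (d_low a `I_2) #= [set: X] /\
     set_sum (k_up b mu) (d_up b mu) #= [set: X])
   \/
   (forall mu : set X, mu #< [set: X] ->
     set_sum (k_low a mu) (d_low a mu) #= [set: X] /\
     set_sum (k_up b `I_2) (d_up b `I_2) #= [set: X])).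
Proof.
move=> gen La Rb; have fgen := flip_full gen.
have fLa : in_R (flip a) by rewrite in_R_flip.
split.
  split; rewrite card_eq_le; apply/andP; split.
  - exact: blocks_card (@d_low_sub a _ _).
  - exact: necessary_low gen Rb.
  - exact: blocks_card (@d_up_sub b _ _).
  - exact: card_le_trans (necessary_low fgen fLa) (d_low_flip _ _).
have a2 := set_sum_full (@k_low_sub a _ _) (@d_low_sub a _ _) (necessary_two gen Rb).
have b2 := set_sum_full (@k_up_sub b _ _) (@d_up_sub b _ _)
  (flip_up_low (necessary_two fgen fLa)).
(* Either [a] meets the condition at every cardinal, which is the second case, or it fails at one
   [mu], and this failure forces the condition on [b] at every [nu]. *)
have [H|/existsNP[mu /not_implyP[muX nmu]]] := pselect (forall mu : set X,
    mu #< [set: X] -> [set: X] #<= k_low a mu `|` d_low a mu).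
  right=> mu /H h; split=> //.
  exact: set_sum_full (@k_low_sub a _ _) (@d_low_sub a _ _) h.
left=> nu nuX; split=> //; apply: set_sum_full (@k_up_sub b _ _) (@d_up_sub b _ _) _.
by case: (necessary_big gen La Rb muX nuX).
Qed.

End Necessity.

(** * Assembly of the two implications *)

Theorem theorem25 (X : Type) (X_infinite : infinite_set [set: X])
    (X_singular : singular [set: X]) (alpha beta : partmon X) :
  [set: partmon X] = subsemigroup_gen (@sym_grp X `|` [set alpha; beta]) <->
  exists a b : partmon X,
    [/\ (a = alpha /\ b = beta) \/ (a = beta /\ b = alpha),
        in_L a, in_R b,
        (d_low a `I_1 #= [set: X] /\ d_up b `I_1 #= [set: X]) &
        (forall mu : set X, mu #< [set: X] ->
           set_sum (k_low a `I_2) (d_low a `I_2) #= [set: X] /\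
           set_sum (k_up b mu) (d_up b mu) #= [set: X])
        \/
        (forall mu : set X, mu #< [set: X] ->
           set_sum (k_low a mu) (d_low a mu) #= [set: X] /\
           set_sum (k_up b `I_2) (d_up b `I_2) #= [set: X])].
Proof.
rewrite -/(generated alpha beta); split=> [E|[a [b [ab La Rb [da db] cond]]]].
  have gen g : generated alpha beta g by rewrite -E.
  have [a [aE La nSa]] := generator_in_L X_infinite gen.
  have [b [bE Rb nSb]] : exists b, [/\ b = alpha \/ b = beta, in_R b & ~ sym_grp b].
    have [c [cE Lc nSc]] := generator_in_L X_infinite (flip_full gen).
    exists (flip c); split; last 2 first.
    - by rewrite in_R_flip.
    - by move=> /sym_grp_flip; rewrite flipK.
    - by case: cE => ->; rewrite flipK; [right|left].
  have [ab gab] : ((a = alpha /\ b = beta) \/ (a = beta /\ b = alpha)) /\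
      forall g, generated a b g.
    (* A single generator in both L_X and R_X would be a unit, so [a] and [b] are the two different
       generators. *)
    case: aE bE => aE [] bE; subst a b; try by case: nSa; exact: in_LR_sym_grp.
      by split=> //; left.
    by split=> [|g]; [right|rewrite generatedC].
  have [dab cond] := necessary X_infinite X_singular gab La Rb.
  by exists a, b.
have full T (S : set T) : S #= [set: X] -> [set: X] #<= S.
  by rewrite card_eq_le => /andP[].
suff gen g : generated a b g.
  apply/esym/seteqP; split=> // g _.
  by case: ab (gen g) => -[-> ->] //; rewrite generatedC.
(* The cardinal 0 serves to extract the clauses that do not depend on [mu]. *)
have mu0 : (set0 : set X) #< [set: X] by split; [exact: card_ge0|exact: not_full0].
case: cond => cond.
  apply: sufficient => //; [exact: full|exact: full|exact/full/(cond _ mu0).1|].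
  by move=> mu /cond[_ /full].
have to_flip M (mu : set M) : set_sum (k_up b mu) (d_up b mu) #= [set: X] ->
    [set: X] #<= set_sum (k_low (flip b) mu) (d_low (flip b) mu).
  move=> /full /card_le_trans; apply.
  by apply: card_le_set_sum; [exact: k_up_flip|exact: d_up_flip].
have of_flip M (mu : set M) : set_sum (k_low a mu) (d_low a mu) #= [set: X] ->
    [set: X] #<= set_sum (k_up (flip a) mu) (d_up (flip a) mu).
  move=> /full /card_le_trans; apply; rewrite -{1 2}(flipK a).
  by apply: card_le_set_sum; [exact: k_low_flip|exact: d_low_flip].
(* The second case is the first one for the reflected pair in reverse order. *)
have : generated (flip b) (flip a) (flip g).
  apply: sufficient => //.
  - by rewrite in_L_flip.
  - by rewrite in_R_flip.
  - exact: card_le_trans (full _ _ db) (d_up_flip _ _).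
  - apply: card_le_trans (full _ _ da) _; rewrite -{1}(flipK a).
    exact: d_low_flip.
  - exact/to_flip/(cond _ mu0).2.
  - by move=> mu /cond[/of_flip].
by move=> /generated_flip; rewrite !flipK generatedC.
Qed.
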